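(* Let $A\in\mathbb{R}^{m\times n}$, $a\in\mathbb{R}^m$, $B\in\mathbb{R}^{l\times n}$, $b\in\mathbb{R}^l$, with $B$ of full row rank, and suppose the polyhedral set $\mathcal{P}=\{y\in\mathbb{R}^n\mid Ay\le a,\ By=b\}$ is nonempty. Let $\Pi_{\mathcal{P}}:\mathbb{R}^n\to\mathbb{R}^n$ be the Euclidean projection onto $\mathcal{P}$. Then the HS-Jacobian $\partial_{HS}\Pi_{\mathcal{P}}:\mathbb{R}^n\rightrightarrows\mathbb{R}^{n\times n}$ is a semi-algebraic mapping. Moreover, it is a conservative mapping for the projection operator $\Pi_{\mathcal{P}}:\mathbb{R}^n\to\mathbb{R}^n$.
   Context: Projection: $\Pi_{\mathcal{P}}(x)=\arg\min_{y\in\mathcal{P}}\frac12\|y-x\|_2^2$. $A_i$ is the $i$th row of $A$; for $K\subseteq\{1,\dots,m\}$, $A_K$ consists of the rows of $A$ indexed by $K$. Active set: $I(x)=\{i\mid A_i\Pi_{\mathcal{P}}(x)=a_i\}$. $M(x)$ is the set of all $(\lambda,\mu)\in\mathbb{R}^m\times\mathbb{R}^l$ such that $\Pi_{\mathcal{P}}(x)-x+A^\top\lambda+B^\top\mu=0$, $A\Pi_{\mathcal{P}}(x)-a\le 0$, $B\Pi_{\mathcal{P}}(x)=b$, $\lambda\ge 0$, $\lambda^\top(A\Pi_{\mathcal{P}}(x)-a)=0$. Let $\mathrm{supp}(\lambda)=\{i\mid\lambda_i>0\}$ and $$\mathcal{E}(x)=\{K\subseteq\{1,\dots,m\}\mid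 \exists(\lambda,\mu)\in M(x)\text{ with }\mathrm{supp}(\lambda)\subseteq K\subseteq I(x),\ \text{and } [A_K^\top\ B^\top]\text{ has full column rank}\}.$$ HS-Jacobian: with $H_K=[A_K^\top\ B^\top]$, $$\partial_{HS}\Pi_{\mathcal{P}}(x)=\{J_K\in\mathbb{R}^{n\times n}\mid K\in\mathcal{E}(x),\ J_K=I_n-H_K(H_K^\top H_K)^{-1}H_K^\top\}.$$ Semi-algebraic: a subset of $\mathbb{R}^N$ is semi-algebraic if it is a finite union of sets of the form $\bigcap_{i=1}^s\{z\in\mathbb{R}^N\mid p_i(z)<0,\ q_i(z)=0\}$ with $p_i,q_i$ real polynomials and $s\ge 1$. A set-valued mapping is semi-algebraic if its graph $\{(x,y)\mid y\in f(x)\}$ is a semi-algebraic set. Conservative mapping: for a locally Lipschitz $f:\mathbb{R}^n\to\mathbb{R}^m$, a set-valued mapping $J_f:\mathbb{R}^n\rightrightarrows\mathbb{R}^{m\times n}$ with nonempty compact values and closed graph is a conservative mapping for $f$ if for any absolutely continuous curve $\gamma:[0,1]\to\mathbb{R}^n$, for almost all $t\in[0,1]$, $\frac{d}{dt}f(\gamma(t))=V\dot\gamma(t)$ for all $V\in J_f(\gamma(t))$. *)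

(* Defs.v *)
From HB Require Import structures.
From mathcomp Require Import all_boot all_order all_algebra.
From mathcomp Require Import all_classical all_reals all_analysis.
(* mpoly is not imported: its notations clash with those of mathcomp-analysis. *)
From mathcomp Require mpoly.

Set Implicit Arguments.
Unset Strict Implicit.
Unset Printing Implicit Defensive.

Import Order.TTheory GRing.Theory Num.Theory.
Import numFieldNormedType.Exports.

Local Open Scope classical_set_scope.
Local Open Scope ring_scope.

(* `|v| on matrices is the max norm, hence this separate definition. *)
Definition norm2 (R : realType) (n : nat) (v : 'cV[R]_n) : R :=
  Num.sqrt (\sum_(i < n) v i 0 ^+ 2).

Definition argmin (R : realType) (T : Type) (P : set T) (f : T -> R) : set T :=
  [set y | P y /\ forall z, P z -> f y <= f z].

(* A junk value unless the argmin set is nonempty. *)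
Definition projection (R : realType) (n : nat) (P : set 'cV[R]_n) (x : 'cV[R]_n) :
    'cV[R]_n :=
  get (argmin P (fun y => 2^-1 * norm2 (y - x) ^+ 2)).

Definition polyhedron (R : realType) (m l n : nat)
    (A : 'M[R]_(m, n)) (a : 'cV[R]_m) (B : 'M[R]_(l, n)) (b : 'cV[R]_l) :
    set 'cV[R]_n :=
  [set y | (forall i, (A *m y) i 0 <= a i 0) /\ B *m y = b].

Section HSJacobian.
Variables (R : realType) (m l n : nat).
Variables (A : 'M[R]_(m, n)) (a : 'cV[R]_m) (B : 'M[R]_(l, n)) (b : 'cV[R]_l).

Local Notation Pi := (projection (polyhedron A a B b)).

Definition active_set (x : 'cV[R]_n) : {set 'I_m} :=
  [set i | (A *m Pi x) i 0 == a i 0]%SET.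

Definition multipliers (x : 'cV[R]_n) : set ('cV[R]_m * 'cV[R]_l) :=
  [set lm | [/\ Pi x - x + A^T *m lm.1 + B^T *m lm.2 = 0,
                forall i, (A *m Pi x - a) i 0 <= 0,
                B *m Pi x = b,
                forall i, 0 <= lm.1 i 0 &
                lm.1^T *m (A *m Pi x - a) = 0]].

Definition supp (lambda : 'cV[R]_m) : {set 'I_m} :=
  [set i | 0 < lambda i 0]%SET.

(* A_K, its rows listed in increasing order of the indices in K. *)
Definition rows_of (K : {set 'I_m}) : 'M[R]_(#|K|, n) :=
  rowsub (fun k : 'I_#|K| => enum_val k) A.

Definition HK (K : {set 'I_m}) : 'M[R]_(n, #|K| + l) :=
  row_mx (rows_of K)^T B^T.

Definition index_sets (x : 'cV[R]_n) : set {set 'I_m} :=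
  [set K : {set 'I_m} |
           (exists lambda mu, [/\ multipliers x (lambda, mu),
                                  supp lambda \subset K &
                                  K \subset active_set x]) /\
           \rank (HK K) = (#|K| + l)%N].

Definition JK (K : {set 'I_m}) : 'M[R]_n :=
  1%:M - HK K *m invmx ((HK K)^T *m HK K) *m (HK K)^T.

Definition HS_jacobian (x : 'cV[R]_n) : set 'M[R]_n :=
  [set J | exists2 K, index_sets x K & J = JK K].

End HSJacobian.

Definition peval (R : realType) (N : nat) (p : mpoly.mpoly N R)
    (z : 'cV[R]_N) : R :=
  mpoly.meval (fun i => z i 0) p.

Definition semialgebraic (R : realType) (N : nat) (S : set 'cV[R]_N) : Prop :=
  exists (r : nat) (s : nat -> nat) (p q : nat -> nat -> mpoly.mpoly N R),
    (forall j, (j < r)%N -> (1 <= s j)%N) /\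
    S = \bigcup_(j in `I_r) \bigcap_(i in `I_(s j))
          [set z | peval (p j i) z < 0 /\ peval (q j i) z = 0].

(* R^n x R^(k x n) is identified with R^(n + k * n) by stacking x on top of the
   row-major listing of the entries of the matrix. *)
Definition semialgebraic_mapping (R : realType) (n k : nat)
    (F : 'cV[R]_n -> set 'M[R]_(k, n)) : Prop :=
  semialgebraic
    [set z : 'cV[R]_(n + k * n) |
      exists x J, F x J /\ z = col_mx x (mxvec J)^T].

Definition abs_continuous01 (R : realType) (n : nat) (g : R -> 'cV[R]_n) :
    Prop :=
  forall e : R, 0 < e -> exists2 d : R, 0 < d &
    forall (N : nat) (s t : 'I_N -> R),
      (forall i, 0 <= s i <= t i /\ t i <= 1) ->
      trivIset setT (fun i => `]s i, t i[%classic) ->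
      \sum_(i < N) (t i - s i) < d ->
      \sum_(i < N) norm2 (g (t i) - g (s i)) < e.

(* The library's [locally [lipschitz f x | x in setT]] asks for a Lipschitz bound
   near every pair (x, y), not only near the diagonal. *)
Definition locally_lipschitz (R : realType) (V W : normedModType R)
    (f : V -> W) : Prop :=
  forall x : V, exists k : R, exists2 U : set V, nbhs x U & k.-lipschitz_U f.

(* Curves are defined on all of R, but only their restriction to [0, 1]
   matters: the endpoints, where the derivative would depend on the extension,
   form a null set. *)
Definition conservative_mapping (R : realType) (n k : nat)
    (f : 'cV[R]_n -> 'cV[R]_k) (J : 'cV[R]_n -> set 'M[R]_(k, n)) : Prop :=
  [/\ locally_lipschitz f,
      forall x, J x !=set0,
      forall x, compact (J x),
      closed [set xV : 'cV[R]_n * 'M[R]_(k, n) | J xV.1 xV.2] &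
      forall g : R -> 'cV[R]_n, abs_continuous01 g ->
        {ae (@lebesgue_measure R), forall t : R, 0 <= t <= 1 ->
          [/\ derivable g t 1, derivable (f \o g) t 1 &
              forall V, J (g t) V -> derive1 (f \o g) t = V *m derive1 g t]}].

(* Main.v *)
Require Import Defs.
From HB Require Import structures.
From mathcomp Require Import all_boot all_order all_algebra.
From mathcomp Require Import all_classical all_reals all_analysis.
From mathcomp Require Import ring lra.
From mathcomp Require Import -(notations) mpoly.

Import Order.TTheory GRing.Theory Num.Theory.
Import numFieldNormedType.Exports.

Local Open Scope classical_set_scope.
Local Open Scope ring_scope.

(** Both halves of the theorem rest on one structural fact: the projection is
    piecewise affine, and the pieces are indexed by the sets K that define the
    HS-Jacobian.  If K belongs to E(x), then the point y = Pi(x) lies on the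
    face A_K y = a_K, B y = b, and x - y lies in the range of H_K; hence
    Pi(x) = J_K x + c_K, where c_K depends on K alone ([projection_affine]).
    Conversely K belongs to E(x) exactly when the point J_K x + c_K is feasible
    and the multipliers of x on K, which are affine functions of x, are
    nonnegative ([index_sets_polyhedral]).  So D_K = {x | K in E(x)} is a
    polyhedron and the graph of the HS-Jacobian is the finite union of the sets
    D_K x {J_K}.  This gives semi-algebraicity and the closed graph at once; the
    values are finite, hence compact.

    Nonemptiness of E(x), and the very existence of the projection, come from a
    single finite argument about nonnegative least squares ([nnls]): a vector v
    has a nearest point in a finitely generated cone, and this point is carried
    by linearly independent generators.  The cone is the one generated by the
    rows of the constraints on y - x, extended by the opposite of their
    right-hand sides.  When v is the unit vector of the extra coordinate and w
    its nearest point, the residual v - w, rescaled so that its last coordinate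
    is 1, gives the displacement Pi(x) - x, and the coefficients of w, rescaled
    alike, are multipliers for it ([kkt_exists]).

    For the chain rule, let g be an absolutely continuous curve.  Pi is
    nonexpansive, so Pi o g is absolutely continuous too, and both curves are
    differentiable almost everywhere ([curve_derivable_ae]).  On the set T_K of
    the times t with g(t) in D_K the function Pi o g - J_K g is constant; at an
    accumulation point of T_K where both curves are differentiable its
    derivative therefore vanishes, that is (Pi o g)' = J_K g'
    ([derive_affine_on]).  The isolated points of T_K are countable, hence
    negligible, and there are only finitely many sets K.

    Almost everywhere differentiability of absolutely continuous functions is
    reduced to that of nondecreasing continuous functions by the total
    variation, and the latter is the classical argument with Vitali coverings
    ([nondecreasing_derivable_ae]). *)

Set Implicit Arguments.
Unset Strict Implicit.
Unset Printing Implicit Defensive.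

(** * Increments of monotone functions and Vitali coverings *)

Section VitaliIntervals.
Variable R : realType.
Notation mu := (@lebesgue_measure R).

(* The sets to be covered need not be measurable: monotonicity and subadditivity
   are those of the outer measure. *)
Let mu_le (A B : set R) : A `<=` B -> (mu A <= mu B)%E.
Proof. exact: (@le_outer_measure _ _ ((wlength idfun)^*)%mu). Qed.

Let muU2 (A B : set R) : (mu (A `|` B) <= mu A + mu B)%E.
Proof. exact: (@outer_measureU2 _ _ ((wlength idfun)^*)%mu). Qed.

Let mu_bigcup (F : nat -> set R) : (mu (\bigcup_n F n) <= \sum_(i <oo) mu (F i))%E.
Proof. exact: (@outer_measure_sigma_subadditive _ _ ((wlength idfun)^*)%mu). Qed.

(** Vitali's theorem for intervals.  The endpoints are rational because the
    covering family has to be countable; the disjoint subfamily is disjoint even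
    with its endpoints, while the open intervals already cover E up to a null
    set, since countably many endpoints are negligible. *)
Lemma vitali_cover_itv (E : set R) (P : R -> R -> Prop) :
  (forall x, E x -> forall e, 0 < e -> exists s t : rat,
     [/\ ratr s < x < ratr t, ratr t - ratr s < e :> R & P (ratr s) (ratr t)]) ->
  exists (D : set nat) (u v : nat -> R),
    [/\ trivIset D (fun k => `[u k, v k]%classic),
        forall k, D k -> u k < v k /\ P (u k) (v k) &
        mu (E `\` \bigcup_(k in D) `]u k, v k[%classic) = 0%E].
Proof.
move=> EP.
pose ok (st : rat * rat) := st.1 < st.2.
(* A number that does not code a rational interval stands for ]0, 1[. *)
pose u n : R := if unpickle n is Some st then
  (if ok st then ratr st.1 else 0) else 0.
pose v n : R := if unpickle n is Some st then
  (if ok st then ratr st.2 else 1) else 1.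
have uv n : u n < v n.
  rewrite /u /v; case: unpickle => [st|]; last exact: ltr01.
  by case: ifPn => [|_]; [rewrite ltr_rat | exact: ltr01].
pose c n := (u n + v n) / 2; pose r n := (v n - u n) / 2.
have r0 n : 0 < r n by rewrite /r divr_gt0// subr_gt0.
pose B n : set R := ball (c n) (r n).
have radB n : (radius (B n))%:num = r n by rewrite radius_ball_num// ltW.
have B0 n : 0 < (radius (B n))%:num by rewrite radB.
have cmr n : c n - r n = u n by rewrite /c /r; field.
have cpr n : c n + r n = v n by rewrite /c /r; field.
have BE n : B n = `]u n, v n[%classic by rewrite /B ball_itv cmr cpr.
have clB n : closure (B n) = `[u n, v n]%classic.
  by rewrite closure_ballE// closed_ball_itv// cmr cpr.
have cov : vitali_cover E B [set n | P (u n) (v n)].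
  split=> [n|x Ex e e0]; first exact: is_ball_ball.
  have [s [t [/andP[sx xt] tse Pst]]] := EP x Ex e e0.
  have st : ok (s, t) by rewrite /ok /= -(ltr_rat R) (lt_trans sx xt).
  have uE : u (pickle (s, t)) = ratr s by rewrite /u pickleK st.
  have vE : v (pickle (s, t)) = ratr t by rewrite /v pickleK st.
  exists (pickle (s, t)); split.
  - by rewrite /= uE vE.
  - by rewrite BE uE vE /= in_itv/= sx xt.
  - rewrite radB /r uE vE ltr_pdivrMr//.
    by apply: (lt_trans tse); rewrite ltr_pMr// ltr1n.
have [D [cD DV tD ED]] := vitali_theorem B0 cov.
exists D, u, v; split.
- by move: tD; congr trivIset; apply/funext => n /=; rewrite clB.
- by move=> k /DV.
apply/eqP; rewrite -measure_le0.
pose X := E `\` \bigcup_(k in D) closure (B k).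
apply: (@le_trans _ _ (mu (X `|` (range u `|` range v)))).
  apply: mu_le => x [Ex nx].
  have [xuv|] := pselect (range u x \/ range v x); first by right.
  move=> /not_orP[xu xv]; left; split => //.
  move=> [k Dk]; rewrite clB /= in_itv/= => /andP[ux vx].
  apply: nx; exists k => //=; rewrite in_itv/= !lt_neqAle ux vx !andbT.
  apply/andP; split; apply/eqP => e; first by apply: xu; exists k.
  by apply: xv; exists k.
apply: (le_trans (muU2 _ _)).
rewrite [X in (X + _)%E](_ : _ = 0%E) ?add0e; last exact: ED.
rewrite [leLHS](_ : _ = 0%E)//.
apply: countable_lebesgue_measure0.
have cr (f : nat -> R) : countable (range f).
  exact: card_le_trans (card_image_le _ _) _.
rewrite -bigcup2E; apply: bigcup_countable => // i _.
by rewrite /bigcup2; case: i => [|[|i]]//=; exact: countable0.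
Qed.

(** An upper derivative of F at x exceeds q: the intervals straddle x, so that
    all four Dini derivatives are treated at once. *)
Definition increments_above (F : R -> R) (q x : R) := forall e : R, 0 < e ->
  exists s t : rat, [/\ ratr s < x < ratr t, ratr t - ratr s < e :> R &
    q * (ratr t - ratr s) < F (ratr t) - F (ratr s)].

Definition increments_below (F : R -> R) (p x : R) := forall e : R, 0 < e ->
  exists s t : rat, [/\ ratr s < x < ratr t, ratr t - ratr s < e :> R &
    F (ratr t) - F (ratr s) < p * (ratr t - ratr s)].

Let mu_oo (a b : R) : a <= b -> mu `]a, b[%classic = (b - a)%:E.
Proof.
rewrite lebesgue_measure_itv/= lte_fin le_eqVlt => /predU1P[->|->//].
by rewrite ltxx subrr.
Qed.

(** The increments are the lengths of the intervals ]F u_k, F v_k[, which are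
    disjoint subintervals of [F a, F b] by monotonicity: the bound is countable
    additivity of Lebesgue measure on the side of the values. *)
Lemma sum_disjoint_increments (F : R -> R) (a b : R) (D : set nat) (u v : nat -> R) :
  {homo F : x y / x <= y} -> a <= b ->
  trivIset D (fun k => `[u k, v k]%classic) ->
  (forall k, D k -> [/\ a <= u k, u k < v k & v k <= b]) ->
  (\sum_(k <oo | k \in D) (F (v k) - F (u k))%:E <= (F b - F a)%:E)%E.
Proof.
move=> Fnd ab tD Duv.
pose G k : set R := `]F (u k), F (v k)[%classic.
have tG : trivIset D G.
  apply/trivIsetP => i j Di Dj ij; apply/seteqP; split => // z [].
  rewrite /G /= !in_itv/= => /andP[ui vi] /andP[uj vj].
  have [_ uvi _] := Duv i Di; have [_ uvj _] := Duv j Dj.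
  have := tD i j Di Dj.
  have [vu _|vu] := ltP (v i) (u j).
    by move: (Fnd _ _ (ltW vu)); rewrite leNgt (lt_trans uj vi).
  have [vu' _|vu'] := ltP (v j) (u i).
    by move: (Fnd _ _ (ltW vu')); rewrite leNgt (lt_trans ui vj).
  move=> H; move/eqP: ij => ij; apply: False_ind; apply: ij; apply: H.
  exists (Num.max (u i) (u j)).
  by split => /=; rewrite in_itv/= le_max ge_max lexx ?orbT/= ?vu ?vu' ?andbT ltW.
have -> : (\sum_(k <oo | k \in D) (F (v k) - F (u k))%:E =
    \sum_(k <oo | k \in D) mu (G k))%E.
  apply: eq_eseriesr => k /set_mem Dk; rewrite /G mu_oo//.
  by apply: Fnd; have [_ /ltW] := Duv k Dk.
rewrite -measure_bigcup//; last by move=> i _; exact: measurable_itv.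
rewrite (_ : (F b - F a)%:E = mu `[F a, F b]%classic); last first.
  rewrite lebesgue_measure_itv/= lte_fin.
  move: (Fnd _ _ ab); rewrite le_eqVlt => /predU1P[->|->//].
  by rewrite ltxx subrr.
apply: mu_le => x [k Dk]; rewrite /G /= !in_itv/= => /andP[ux xv].
have [au uv vb] := Duv k Dk.
by rewrite (le_trans (Fnd _ _ au) (ltW ux)) (le_trans (ltW xv) (Fnd _ _ vb)).
Qed.

Let mu_bigcup_in (D : set nat) (F : nat -> set R) :
  (mu (\bigcup_(n in D) F n) <= \sum_(i <oo | i \in D) mu (F i))%E.
Proof.
rewrite bigcup_mkcond; apply: (le_trans (mu_bigcup _)).
rewrite [leRHS]eseries_mkcond; apply: lee_nneseries => // i _.
by case: ifPn => // _; rewrite measure0.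
Qed.

Let mu_cover (E : set R) (D : set nat) (U : nat -> set R) :
  mu (E `\` \bigcup_(k in D) U k) = 0%E ->
  (mu E <= \sum_(i <oo | i \in D) mu (E `&` U i))%E.
Proof.
move=> E0; apply: le_trans (mu_bigcup_in D (fun i => E `&` U i)).
rewrite -[leRHS]add0e -E0; apply: le_trans (muU2 _ _); apply: mu_le => x Ex.
have [Dx|Dx] := pselect ((\bigcup_(k in D) U k) x); last by left.
by right; case: Dx => k Dk Ux; exists k.
Qed.

Let mu_scale_le (E : set R) (D : set nat) (U : nat -> set R) (q : R)
    (c : nat -> R) : 0 <= q ->
  mu (E `\` \bigcup_(k in D) U k) = 0%E ->
  (forall k, D k -> (q%:E * mu (E `&` U k) <= (c k)%:E)%E) ->
  (q%:E * mu E <= \sum_(k <oo | k \in D) (c k)%:E)%E.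
Proof.
move=> q0 E0 Uc.
apply: (@le_trans _ _ (q%:E * \sum_(i <oo | i \in D) mu (E `&` U i))%E).
  by apply: lee_wpmul2l; [rewrite lee_fin|exact: mu_cover].
rewrite -nneseriesZl//; apply: lee_nneseries => k; first by rewrite mule_ge0.
by move=> /set_mem; exact: Uc.
Qed.

(** A Vitali cover of E by intervals of slope greater than q has total length at
    least the measure of E and total increment at most F b - F a. *)
Lemma mu_increments_above (F : R -> R) (a b q : R) (E : set R) :
  {homo F : x y / x <= y} -> a <= b -> 0 <= q -> E `<=` `]a, b[%classic ->
  (forall x, E x -> increments_above F q x) ->
  (q%:E * mu E <= (F b - F a)%:E)%E.
Proof.
move=> Fnd ab q0 Eab Eq.
pose P s t := [/\ a <= s, t <= b & q * (t - s) <= F t - F s].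
have [|D [u [v [tD Duv ED]]]] := @vitali_cover_itv E P.
  move=> x Ex e e0; have /Eab := Ex; rewrite /= in_itv/= => /andP[ax xb].
  have m0 : 0 < Num.min e (Num.min (x - a) (b - x)).
    by rewrite !lt_min e0 !subr_gt0 ax xb.
  have [s [t [/andP[sx xt]]]] := Eq x Ex _ m0.
  rewrite !lt_min => /and3P[ste sta stb] st; exists s, t; split => //.
    by rewrite sx xt.
  by split; [lra|lra|exact: ltW].
apply: le_trans (sum_disjoint_increments Fnd ab tD _); last first.
  by move=> k /Duv[uv [au vb _]].
apply: mu_scale_le ED _ => // k /Duv[uv [_ _ Puv]].
apply: (@le_trans _ _ (q%:E * (v k - u k)%:E)%E); last by rewrite lee_fin.
apply: lee_wpmul2l; first by rewrite lee_fin.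
by rewrite -mu_oo ?(ltW uv)//; apply: mu_le => x [].
Qed.

(** Cover E inside U by disjoint intervals of slope less than p, whose total
    increment is at most p times the measure of U; then apply
    [mu_increments_above] inside each of them. *)
Lemma mu_increments_above_below (F : R -> R) (p q : R) (E U : set R) :
  {homo F : x y / x <= y} -> 0 <= p -> 0 <= q -> open U -> E `<=` U ->
  (forall x, E x -> increments_above F q x /\ increments_below F p x) ->
  (q%:E * mu E <= p%:E * mu U)%E.
Proof.
move=> Fnd p0 q0 oU EU Epq.
pose P s t := `[s, t]%classic `<=` U /\ F t - F s <= p * (t - s).
have [|D [u [v [tD Duv ED]]]] := @vitali_cover_itv E P.
  move=> x Ex e e0.
  have /nbhs_ballP[d /= d0 dU] : nbhs x U by exact/open_nbhs_nbhs/(conj oU (EU _ Ex)).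
  have m0 : 0 < Num.min e d by rewrite lt_min e0 d0.
  have [_ /(_ _ m0)[s [t [/andP[sx xt]]]]] := Epq x Ex.
  rewrite !lt_min => /andP[ste std] st; exists s, t; split => //.
    by rewrite sx xt.
  split; last exact: ltW.
  move=> y; rewrite /= in_itv/= => /andP[sy yt]; apply: dU.
  rewrite /ball/= ltr_norml; apply/andP; split; lra.
have tD' : trivIset D (fun k => `]u k, v k[%classic).
  move=> i j Di Dj [x [xi xj]]; apply: tD => //; exists x.
  by split; [move: xi|move: xj]; rewrite /= !in_itv/= => /andP[/ltW-> /ltW->].
apply: (@le_trans _ _ (\sum_(k <oo | k \in D) (p * (v k - u k))%:E)%E).
  apply: mu_scale_le ED _ => // k /Duv[uv [_ Fp]].
  apply: (@le_trans _ _ (F (v k) - F (u k))%:E); last by rewrite lee_fin.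
  apply: mu_increments_above => //; first exact: ltW.
  by move=> x [/Epq[]].
have -> : (\sum_(k <oo | k \in D) (p * (v k - u k))%:E =
    \sum_(k <oo | k \in D) p%:E * mu `]u k, v k[%classic)%E.
  by apply: eq_eseriesr => k /set_mem /Duv[uv _]; rewrite mu_oo ?ltW// EFinM.
rewrite nneseriesZl//; apply: lee_wpmul2l; first by rewrite lee_fin.
rewrite -measure_bigcup//.
apply: mu_le => x [k Dk]; rewrite /= in_itv/= => /andP[ux xv].
by have [_ [+ _]] := Duv k Dk; apply; rewrite /= in_itv/= !ltW.
Qed.

(** With U shrinking to E, outer regularity gives q mu(E) <= p mu(E), where
    p < q and mu(E) is finite. *)
Lemma mu_oscillating_increments (F : R -> R) (a b p q : R) :
  {homo F : x y / x <= y} -> 0 <= p < q ->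
  mu [set x | [/\ a < x < b, increments_above F q x & increments_below F p x]] = 0%E.
Proof.
move=> Fnd /andP[p0 pq]; set E := [set x | _].
have q0 : 0 < q by exact: le_lt_trans pq.
have Efin : mu E \is a fin_num.
  rewrite ge0_fin_numE//; apply: (@le_lt_trans _ _ (mu `]a, b[%classic)).
    by apply: mu_le => x [+ _ _]; rewrite /= in_itv.
  by rewrite lebesgue_measure_itv/=; case: ifP => _; rewrite -?EFinB ltry.
have : forall e : R, 0 < e -> q * fine (mu E) <= p * (fine (mu E) + e).
  move=> e e0; have [U [oU EU Ue]] := outer_measure_open_le E e0.
  rewrite -lee_fin EFinM fineK// EFinM EFinD fineK//.
  apply: (@le_trans _ _ (p%:E * mu U)%E).
    by apply: (mu_increments_above_below Fnd) (ltW q0) oU EU _ => // x [_ xq xp].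
  by apply: lee_wpmul2l; rewrite ?lee_fin.
move=> H; have m0 : 0 <= fine (mu E) by exact: fine_ge0.
rewrite -(fineK Efin); congr EFin; apply/eqP; rewrite eq_le m0 andbT leNgt.
apply/negP => m1.
(* p e < (q - p) mu(E), because 2 q > p: any such e contradicts H. *)
have e0 : 0 < (q - p) * fine (mu E) / (2 * q).
  by rewrite divr_gt0 ?mulr_gt0// subr_gt0.
have := H _ e0; apply/negP; rewrite -ltNge.
rewrite mulrDr -ltrBrDl -mulrBl mulrA ltr_pdivrMr ?mulr_gt0//.
have : 0 < (q - p) * fine (mu E) by rewrite mulr_gt0// subr_gt0.
move: (fine (mu E)) m1 => m m1 qpm; nra.
Qed.

Lemma mu_infinite_increments (F : R -> R) (a b : R) :
  {homo F : x y / x <= y} ->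
  mu [set x | a < x < b /\ forall n, increments_above F n%:R x] = 0%E.
Proof.
move=> Fnd; set E := [set x | _].
have [ab|ba] := leP a b; last first.
  rewrite (_ : E = set0) ?measure0//; apply/seteqP; split => // x [/andP[ax xb]].
  by move: ba; rewrite ltNge (ltW (lt_trans ax xb)).
have H n : (n%:R%:E * mu E <= (F b - F a)%:E)%E.
  apply: mu_increments_above => //.
    by move=> x [+ _]; rewrite /= in_itv.
  by move=> x [_].
have Efin : mu E \is a fin_num.
  by rewrite ge0_fin_numE// -[mu E]mul1e; exact: le_lt_trans (H 1%N) (ltry _).
rewrite -(fineK Efin); congr EFin; apply/eqP.
rewrite eq_le fine_ge0// andbT leNgt; apply/negP => m0.
have A0 : 0 <= (F b - F a) / fine (mu E).
  by rewrite divr_ge0 ?fine_ge0// subr_ge0 Fnd.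
have := archi_boundP A0; rewrite ltr_pdivrMr// ltNge => /negP; apply.
by rewrite -lee_fin EFinM fineK.
Qed.

End VitaliIntervals.

(** * Monotone continuous functions are differentiable almost everywhere *)

Section MonotoneDerivable.
Variable R : realType.
Notation mu := (@lebesgue_measure R).
Implicit Types (F G : R -> R) (x : R).

(** A continuous function lets the endpoints of an interval with positive
    increment be moved outwards to rational points. *)
Lemma rat_increment G x y e : continuous G -> x < y -> y - x < e -> G x < G y ->
  exists s t : rat,
    [/\ ratr s < x, y < ratr t, ratr t - ratr s < e & G (ratr s) < G (ratr t)].
Proof.
move=> cG xy xye Gxy; pose c := (G x + G y) / 2.
have Gxc : G x < c by rewrite /c; lra.
have Gcy : c < G y by rewrite /c; lra.
have /nbhs_ballP[d1 /= d10 d1P] : \forall z \near x, G z < c.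
  by exact: cvgr_lt (cG x) _ Gxc.
have /nbhs_ballP[d2 /= d20 d2P] : \forall z \near y, c < G z.
  by exact: cvgr_gt (cG y) _ Gcy.
pose d3 := (e - (y - x)) / 2.
have d30 : 0 < d3 by rewrite /d3; lra.
have /rat_in_itvoo[s] : x - Num.min d1 d3 < x by rewrite ltrBlDr ltrDl lt_min d10.
have /rat_in_itvoo[t] : y < y + Num.min d2 d3 by rewrite ltrDl lt_min d20.
rewrite !in_itv/= => /andP[yt]; rewrite -ltrBlDl lt_min => /andP[td2 td3].
move=> /andP[+ sx]; rewrite ltrBlDr -ltrBlDl lt_min => /andP[sd1 sd3].
exists s, t; split => //; first by rewrite /d3 in td3 sd3; lra.
apply: (@lt_trans _ _ c); [apply: d1P|apply: d2P];
  by rewrite /ball/= ltr_norml; apply/andP; split; lra.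
Qed.

Definition slope F x h := h^-1 * (F (h + x) - F x).

Lemma dnbhs0P (P : R -> Prop) :
  (\forall h \near 0^', P h) <-> exists2 e, 0 < e & forall h, `|h| < e -> h != 0 -> P h.
Proof.
split=> [[e /= e0 eP]|[e e0 eP]].
  by exists e => // h he h0; apply: eP => //=; rewrite sub0r normrN.
by exists e => // h /=; rewrite sub0r normrN => he h0; exact: eP.
Qed.

(** The form of [rat_increment] for difference quotients, to be applied to
    G = F - q id and to G = p id - F. *)
Lemma exists_rat_increment G x h e : continuous G -> 0 < e -> h != 0 -> `|h| < e ->
  0 < h^-1 * (G (h + x) - G x) ->
  exists s t : rat, [/\ ratr s < x < ratr t, ratr t - ratr s < e &
    G (ratr s) < G (ratr t)].
Proof.
move=> cG e0 h0 he Gh; have [hneg|hpos|/eqP] := ltgtP h 0; last by rewrite (negbTE h0).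
- have [||| s [t [s1 t1 st Gst]]] := @rat_increment G (h + x) x e cG.
  + lra.
  + by rewrite ltr0_norm// in he; lra.
  + move: Gh; rewrite nmulr_rgt0 ?invr_lt0//; lra.
  + exists s, t; split => //; apply/andP; split => //; lra.
- have [||| s [t [s1 t1 st Gst]]] := @rat_increment G x (h + x) e cG.
  + lra.
  + by rewrite gtr0_norm// in he; lra.
  + move: Gh; rewrite pmulr_rgt0 ?invr_gt0//; lra.
  + exists s, t; split => //; apply/andP; split => //; lra.
Qed.

Lemma slope_le_near F x q : continuous F -> ~ increments_above F q x ->
  \forall h \near 0^', slope F x h <= q.
Proof.
move=> cF /existsNP[e /not_implyP[e0 nE]]; apply/dnbhs0P; exists e => // h he h0.
rewrite leNgt; apply/negP => qh; apply: nE.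
have cG : continuous (fun z => F z - q * z).
  move=> z; apply: cvgB; first exact: cF.
  by apply: cvgM; [exact: cvg_cst|exact: cvg_id].
set G := (fun z => _) in cG.
have Gh : 0 < h^-1 * (G (h + x) - G x).
  rewrite (_ : _ * _ = slope F x h - q) ?subr_gt0//.
  by rewrite /G /slope; field.
have [s [t [sxt ste Gst]]] := exists_rat_increment cG e0 h0 he Gh.
by exists s, t; split => //; rewrite /G in Gst; lra.
Qed.

Lemma slope_ge_near F x p : continuous F -> ~ increments_below F p x ->
  \forall h \near 0^', p <= slope F x h.
Proof.
move=> cF /existsNP[e /not_implyP[e0 nE]]; apply/dnbhs0P; exists e => // h he h0.
rewrite leNgt; apply/negP => qh; apply: nE.
have cG : continuous (fun z => p * z - F z).
  move=> z; apply: cvgB; last exact: cF.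
  by apply: cvgM; [exact: cvg_cst|exact: cvg_id].
set G := (fun z => _) in cG.
have Gh : 0 < h^-1 * (G (h + x) - G x).
  rewrite (_ : _ * _ = p - slope F x h) ?subr_gt0//.
  by rewrite /G /slope; field.
have [s [t [sxt ste Gst]]] := exists_rat_increment cG e0 h0 he Gh.
by exists s, t; split => //; rewrite /G in Gst; lra.
Qed.

(** The derivative is the supremum L of the numbers that are eventually below
    the difference quotient.  Were the quotient frequently above L + e, then for
    rationals L < p < q < L + e it would be frequently above q, and frequently
    below p by definition of L. *)
Lemma nondecreasing_derivable F x n : continuous F -> {homo F : y z / y <= z} ->
  ~ increments_above F n%:R x ->
  (forall p q : rat, 0 <= p < q ->
    ~ (increments_above F (ratr q) x /\ increments_below F (ratr p) x)) ->
  derivable F x 1.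
Proof.
move=> cF Fnd Fn Fpq.
pose S := [set q | \forall h \near 0^', q <= slope F x h].
have S0 : S 0.
  apply/dnbhs0P; exists 1 => // h _ h0; rewrite /slope.
  have [hneg|hpos|/eqP] := ltgtP h 0; last by rewrite (negbTE h0).
    by rewrite nmulr_rge0 ?invr_lt0// subr_le0 Fnd//; lra.
  by rewrite pmulr_rge0 ?invr_gt0// subr_ge0 Fnd//; lra.
have Sn : ubound S n%:R.
  move=> q Sq; have Sn := slope_le_near cF Fn.
  by have [h [/le_trans]] := filter_ex (filterI Sq Sn); apply.
have supS : has_sup S by split; [exists 0|exists n%:R].
apply/cvg_ex; exists (sup S).
have slopeE : (fun h => h^-1 *: ((F \o shift x) (h *: 1) - F x)) = slope F x.
  by apply/funext => h; rewrite /slope /= /GRing.scale/= mulr1.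
rewrite slopeE; apply/cvgrPdist_le => e e0.
have [q Sq qS] := sup_adherent e0 supS.
have L0 : 0 <= sup S by apply: ub_le_sup => //; exists n%:R.
have /rat_in_itvoo[q2] : sup S < sup S + e by rewrite ltrDl.
rewrite in_itv/= => /andP[Sq2 q2e].
have /rat_in_itvoo[p] := Sq2; rewrite in_itv/= => /andP[Sp pq2].
have pq : 0 <= p < q2.
  rewrite -(ltr_rat R) pq2 andbT -(ler_rat R) rmorph0.
  exact: ltW (le_lt_trans L0 Sp).
have bp : increments_below F (ratr p) x.
  apply: contrapT => /(slope_ge_near cF) Spp.
  have : ratr p <= sup S by apply: ub_le_sup => //; exists n%:R.
  by rewrite leNgt Sp.
have : ~ increments_above F (ratr q2) x by move=> aq; apply: (Fpq p q2 pq).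
move=> /(slope_le_near cF) Sq2'; near=> h.
have h1 : q <= slope F x h by near: h.
have h2 : slope F x h <= ratr q2 by near: h.
rewrite ler_norml; apply/andP; split; lra.
Unshelve. all: by end_near. Qed.

(** The exceptional set is contained in a countable union of null sets, indexed
    by the pairs of rationals p < q, and the null set of infinite upper
    derivatives. *)
Theorem nondecreasing_derivable_ae F a b : continuous F ->
  {homo F : y z / y <= z} ->
  mu.-negligible [set x | a < x < b /\ ~ derivable F x 1].
Proof.
move=> cF Fnd.
pose Epq (pq : rat * rat) := [set x | [/\ a < x < b,
   increments_above F (ratr pq.2) x & increments_below F (ratr pq.1) x] /\
   0 <= pq.1 < pq.2 ].
pose Eoo := [set x | a < x < b /\ forall n, increments_above F n%:R x].
have mu0neg A : mu A = 0%E -> mu.-negligible A.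
  by move=> A0; apply/negligible_outer_measure.
have negEpq pq : mu.-negligible (Epq pq).
  have [pq1|npq] := pselect (0 <= pq.1 < pq.2); last first.
    have -> : Epq pq = set0 by apply/seteqP; split => // x [].
    exact: negligible_set0.
  apply: mu0neg; rewrite [X in mu X](_ : _ = [set x | [/\ a < x < b,
   increments_above F (ratr pq.2) x & increments_below F (ratr pq.1) x]]).
    apply: mu_oscillating_increments => //.
    by move/andP: pq1 => [p0 pq2]; rewrite -(rmorph0 ratr) ler_rat ltr_rat p0.
  by apply/seteqP; split => x // [].
pose U n := if unpickle n is Some pq then Epq pq else set0.
have : mu.-negligible (Eoo `|` \bigcup_n U n).
  apply: negligibleU; first exact/mu0neg/mu_infinite_increments.
  apply: negligible_bigcup => n; rewrite /U; case: unpickle => //.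
  exact: negligible_set0.
apply: negligibleS => x [xab nd]; apply: contrapT => /not_orP[nEoo nU]; apply: nd.
have [n Fn] : exists n, ~ increments_above F n%:R x.
  by apply: contrapT => /forallNP H; apply: nEoo; split => // n; apply: contrapT.
apply: nondecreasing_derivable Fn _ => // p q pq [Fq Fp]; apply: nU.
exists (pickle (p, q)); first by [].
by rewrite /U pickleK; split; [split|].
Qed.

End MonotoneDerivable.

(** * Absolutely continuous functions are differentiable almost everywhere *)

Section AbsolutelyContinuous.
Variable R : realType.
Notation mu := (@lebesgue_measure R).
Implicit Types (h : R -> R).

Definition abs_continuous01_real h := forall e : R, 0 < e -> exists2 d : R, 0 < d &
  forall (N : nat) (s t : 'I_N -> R),
    (forall i, 0 <= s i <= t i /\ t i <= 1) ->
    trivIset setT (fun i => `]s i, t i[%classic) ->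
    \sum_(i < N) (t i - s i) < d ->
    \sum_(i < N) `|h (t i) - h (s i)| < e.

(** Composition with the retraction onto [0, 1] turns a function known on [0, 1]
    into one that is continuous, or monotone, on the whole line. *)
Definition clamp01 (x : R) := Num.max 0 (Num.min x 1).

Lemma clamp01_itv x : 0 <= clamp01 x <= 1.
Proof. by rewrite /clamp01 le_max lexx/= ge_max ler01/= ge_min lexx orbT. Qed.

Lemma clamp01_id x : 0 <= x <= 1 -> clamp01 x = x.
Proof. by move=> /andP[x0 x1]; rewrite /clamp01 min_l// max_r. Qed.

Lemma clamp01_homo : {homo clamp01 : x y / x <= y}.
Proof.
move=> x y xy; rewrite /clamp01 ge_max !le_max lexx/=; apply/orP; right.
by rewrite le_min !ge_min xy lexx orbT.
Qed.

Lemma clamp01_dist x y : x <= y -> clamp01 y - clamp01 x <= y - x.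
Proof.
by move=> xy; rewrite /clamp01 /Num.max /Num.min; repeat case: ifPn;
  rewrite -?leNgt; move=> *; lra.
Qed.

Lemma clamp01_continuous : continuous clamp01.
Proof.
move=> x; apply/cvgrPdist_lt => e e0; near=> y.
apply: (@le_lt_trans _ _ `|x - y|); last first.
  by near: y; exact: (@cvgr_dist_lt _ _ _ (nbhs x) _ id x).
have [xy|yx] := leP x y.
  rewrite distrC [leRHS]distrC !ger0_norm ?subr_ge0//; first exact: clamp01_dist.
  exact: clamp01_homo.
rewrite !ger0_norm ?subr_ge0//; [exact/clamp01_dist/ltW|exact: ltW|].
exact/clamp01_homo/ltW.
Unshelve. all: by end_near. Qed.

Lemma abs_continuous01_clamp_continuous h : abs_continuous01_real h ->
  continuous (h \o clamp01).
Proof.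
move=> hac x; apply/cvgrPdist_lt => e e0.
have [d d0 dP] := hac e e0.
have H u v : u <= v -> v - u < d -> `|h (clamp01 v) - h (clamp01 u)| < e.
  move=> uv uvd.
  have := dP 1%N (fun=> clamp01 u) (fun=> clamp01 v); rewrite !big_ord1; apply => //.
  - move=> _; have /andP[-> _] := clamp01_itv u.
    by have /andP[_ ->] := clamp01_itv v; rewrite clamp01_homo.
  - by move=> i j _ _ _; rewrite !ord1.
  - exact: le_lt_trans (clamp01_dist uv) uvd.
near=> y; have xyd : `|x - y| < d.
  by near: y; exact: (@cvgr_dist_lt _ _ _ (nbhs x) _ id x).
rewrite /=; have [xy|/ltW yx] := leP x y.
  by rewrite distrC H//; rewrite distrC ger0_norm ?subr_ge0// in xyd.
by rewrite H//; rewrite ger0_norm ?subr_ge0// in xyd.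
Unshelve. all: by end_near. Qed.

(** The intervals of a partition form a disjoint family of total length b - c,
    to which the defining property of d applies with the bound 1. *)
Lemma bounded_variation_short h d c b :
  (forall (N : nat) (s t : 'I_N -> R),
    (forall i, 0 <= s i <= t i /\ t i <= 1) ->
    trivIset setT (fun i => `]s i, t i[%classic) ->
    \sum_(i < N) (t i - s i) < d ->
    \sum_(i < N) `|h (t i) - h (s i)| < 1) ->
  0 <= c -> b <= 1 -> b - c < d -> bounded_variation c b h.
Proof.
move=> dP c0 b1 bcd; exists 1 => _ [s cbs <-]; rewrite /variation big_mkord.
pose z := nth b (c :: s); apply/ltW/(dP _ (fun i => z i) (fun i => z i.+1)).
- have zS (k : nat) : (k < size s)%N -> z k <= z k.+1.
    have idnd : {in `[c, b] &, {homo @id R : x y / x <= y}} by [].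
    exact: (nondecreasing_fun_itv_partition idnd cbs).
  move=> i; rewrite zS//; split.
    rewrite andbT; apply: le_trans c0 _; apply: itv_partition_nth_ge => //.
    by rewrite ltnS ltnW.
  by apply: (le_trans _ b1); apply: itv_partition_nth_le; rewrite ?ltnS.
- have zle (i j : nat) : (i <= j)%N -> (j <= size s)%N -> z i <= z j.
    rewrite leq_eqVlt => /predU1P[->//|ij] js.
    apply/ltW/(sorted_ltn_nth lt_trans) => //=; rewrite ?inE/=.
    + by case: cbs.
    + by rewrite ltnS (leq_trans (ltnW ij)).
  move=> i j _ _ [x []] /=; rewrite !in_itv/= => /andP[zix xzi] /andP[zjx xzj].
  apply/val_inj => /=; have [ij|ji|//] := ltngtP (i : nat) j.
    have zz := zle i.+1 j ij (ltnW (ltn_ord j)).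
    by have := lt_le_trans (lt_trans zjx xzi) zz; rewrite ltxx.
  have zz := zle j.+1 i ji (ltnW (ltn_ord i)).
  by have := lt_le_trans (lt_trans zix xzj) zz; rewrite ltxx.
- rewrite -(big_mkord xpredT (fun i : nat => z i.+1 - z i)) telescope_sumr//.
  by rewrite /z (itv_partition_nth_size _ cbs).
Qed.

Lemma abs_continuous01_bounded_variation h : abs_continuous01_real h ->
  bounded_variation 0 1 h.
Proof.
move=> /(_ _ ltr01)[d d0 dP].
(* Intervals of length d / 2 are short enough, and n of them reach c. *)
have step (n : nat) c : 0 <= c <= 1 -> c <= n%:R * (d / 2) -> bounded_variation 0 c h.
  elim: n c => [|n ih] c /andP[c0 c1] cn.
    have -> : c = 0 by apply/eqP; rewrite eq_le c0 andbT (le_trans cn)// mul0r.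
    exact: bounded_variationxx.
  have [cd|cd] := leP c (d / 2).
    by apply: (@bounded_variation_short _ d) => //; lra.
  pose c' := c - d / 2.
  have c'0 : 0 <= c' by rewrite /c'; lra.
  have c'c : c' <= c by rewrite /c'; lra.
  apply/bounded_variationP => //; rewrite (total_variationD h c'0 c'c) fin_numD.
  apply/andP; split; apply/bounded_variationP => //.
    apply: ih; first by apply/andP; split; lra.
    by move: cn; rewrite /c' -natr1 mulrDl mul1r; lra.
  by apply: (@bounded_variation_short _ d) => //; rewrite /c'; lra.
apply: (step (Num.truncn (2 / d)).+1); first by rewrite lexx ler01.
have := truncnS_gt (2 / d); rewrite ltr_pdivrMr// => ?; lra.
Qed.

(** The total variation T of h on [0, x] and T - h are continuous and
    nondecreasing, the latter because an increment of h is at most the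
    variation of h. *)
Theorem abs_continuous01_derivable_ae h : abs_continuous01_real h ->
  mu.-negligible [set x | 0 < x < 1 /\ ~ derivable h x 1].
Proof.
move=> hac; have bv := abs_continuous01_bounded_variation hac.
pose T x := fine (total_variation 0 x h).
have Tadd x y : 0 <= x -> x <= y -> y <= 1 -> T y - T x = fine (total_variation x y h).
  move=> x0 xy y1; rewrite /T (total_variationD h x0 xy) fineD.
  - by rewrite addrC addKr.
  - by apply/bounded_variationP => //; exact: bounded_variationl (le_trans xy y1) bv.
  - apply/bounded_variationP => //; apply: (@bounded_variationr _ 0 _ y) => //.
    by apply: bounded_variationl y1 bv; exact: le_trans xy.
have Tge x y : 0 <= x -> x <= y -> y <= 1 -> `|h y - h x| <= T y - T x.
  move=> x0 xy y1; rewrite Tadd// -lee_fin fineK; first exact: total_variation_ge.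
  apply/bounded_variationP => //; apply: (@bounded_variationr _ 0 _ y) => //.
  by apply: bounded_variationl y1 bv; exact: le_trans xy.
pose F1 := T \o clamp01; pose F2 := F1 \- (h \o clamp01).
have ch := abs_continuous01_clamp_continuous hac.
have cT : {within `[0, 1], continuous T}.
  apply: total_variation_continuous => //.
  have : {within `[0, 1], continuous (h \o clamp01)} by exact: continuous_subspaceT.
  apply: subspace_eq_continuous => x; rewrite inE/= in_itv/= => x01.
  by rewrite /from_subspace /= clamp01_id.
have cF1 : continuous F1.
  move=> x; have x01 := clamp01_itv x.
  move/subspace_continuousP : cT => /(_ (clamp01 x)); rewrite /= in_itv/= => /(_ x01).
  apply: cvg_comp => A; rewrite /= nbhs_simpl /within/= => wA.
  have := clamp01_continuous wA; rewrite nbhs_simpl /=.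
  by apply: filterS => y /=; apply; rewrite in_itv/= clamp01_itv.
have cF2 : continuous F2 by move=> x; apply: cvgB; [exact: cF1|exact: ch].
have F1nd : {homo F1 : x y / x <= y}.
  move=> x y xy; rewrite -subr_ge0.
  apply: le_trans (Tge _ _ _ (clamp01_homo xy) _) => //.
    by have /andP[] := clamp01_itv x.
  by have /andP[] := clamp01_itv y.
have F2nd : {homo F2 : x y / x <= y}.
  move=> x y xy; rewrite /F2 /F1 /=.
  have /andP[x0 _] := clamp01_itv x; have /andP[_ y1] := clamp01_itv y.
  have := Tge _ _ x0 (clamp01_homo xy) y1.
  by move=> /(le_trans (ler_norm _)); lra.
apply: negligibleS (negligibleU (nondecreasing_derivable_ae 0 1 cF1 F1nd)
  (nondecreasing_derivable_ae 0 1 cF2 F2nd)).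
move=> x [x01 nd]; apply: contrapT => /not_orP[nF1 nF2]; apply: nd.
have dF1 : derivable F1 x 1 by exact: contrapT (fun nd => nF1 (conj x01 nd)).
have dF2 : derivable F2 x 1 by exact: contrapT (fun nd => nF2 (conj x01 nd)).
apply: near_eq_derivable (derivableB dF1 dF2).
have : \forall y \near x, y \in `]0, 1[ by apply: near_in_itvoo; rewrite in_itv.
apply: filterS => y; rewrite in_itv/= => /andP[y0 y1].
change (F1 y - (F1 y - h (clamp01 y)) = h y).
by rewrite subKr clamp01_id// !ltW.
Qed.

End AbsolutelyContinuous.

(** * Inner products and orthogonal projection onto the range of H_K *)

Section Dot.
Variable R : realType.

Definition dot n (u v : 'cV[R]_n) : R := (u^T *m v) 0 0.

Lemma dotE n (u v : 'cV[R]_n) : dot u v = \sum_i u i 0 * v i 0.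
Proof. by rewrite /dot mxE; apply: eq_bigr => i _; rewrite mxE. Qed.

Lemma dotC n (u v : 'cV[R]_n) : dot u v = dot v u.
Proof. by rewrite !dotE; apply: eq_bigr => i _; rewrite mulrC. Qed.

Lemma dotDl n (u v w : 'cV[R]_n) : dot (u + v) w = dot u w + dot v w.
Proof. by rewrite /dot linearD/= mulmxDl mxE. Qed.

Lemma dotZl n c (u w : 'cV[R]_n) : dot (c *: u) w = c * dot u w.
Proof. by rewrite /dot linearZ/= -scalemxAl mxE. Qed.

Lemma dotNl n (u w : 'cV[R]_n) : dot (- u) w = - dot u w.
Proof. by rewrite -scaleN1r dotZl mulN1r. Qed.

Lemma dotDr n (u v w : 'cV[R]_n) : dot w (u + v) = dot w u + dot w v.
Proof. by rewrite !(dotC w) dotDl. Qed.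

Lemma dotZr n c (u w : 'cV[R]_n) : dot w (c *: u) = c * dot w u.
Proof. by rewrite !(dotC w) dotZl. Qed.

Lemma dotNr n (u w : 'cV[R]_n) : dot w (- u) = - dot w u.
Proof. by rewrite !(dotC w) dotNl. Qed.

Lemma dot0l n (w : 'cV[R]_n) : dot 0 w = 0.
Proof. by rewrite /dot linear0 mul0mx mxE. Qed.

Lemma dot0r n (w : 'cV[R]_n) : dot w 0 = 0.
Proof. by rewrite dotC dot0l. Qed.

Definition dotE_lin := (dotDl, dotDr, dotNl, dotNr, dotZl, dotZr).

Lemma dot_mulmx n p (M : 'M[R]_(n, p)) u v : dot (M *m u) v = dot u (M^T *m v).
Proof. by rewrite /dot trmx_mul mulmxA. Qed.

Lemma dot_ge0 n (u : 'cV[R]_n) : 0 <= dot u u.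
Proof. by rewrite dotE sumr_ge0// => i _; rewrite -expr2 sqr_ge0. Qed.

Lemma dot_eq0 n (u : 'cV[R]_n) : (dot u u == 0) = (u == 0).
Proof.
apply/eqP/eqP => [|->]; last exact: dot0l.
move=> /eqP; rewrite dotE psumr_eq0 => [/allP u0|j _]; last first.
  by rewrite -expr2 sqr_ge0.
apply/colP => i; rewrite mxE; have := u0 i (mem_index_enum _).
by rewrite /= mulf_eq0 orbb => /eqP.
Qed.

Lemma dot_gt0 n (u : 'cV[R]_n) : (0 < dot u u) = (u != 0).
Proof. by rewrite lt_neqAle dot_ge0 andbT eq_sym dot_eq0. Qed.

Lemma norm2_sqr n (u : 'cV[R]_n) : norm2 u ^+ 2 = dot u u.
Proof.
rewrite /norm2 sqr_sqrtr.
  by rewrite dotE; apply: eq_bigr => i _; rewrite expr2.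
by rewrite sumr_ge0// => i _; rewrite sqr_ge0.
Qed.

End Dot.

Section FullColumnRank.
Variables (R : realType) (m l N : nat) (G : 'M[R]_(m, N)) (H : 'M[R]_(l, N)).
Implicit Types (K : {set 'I_m}) (lam : 'cV[R]_m) (mu : 'cV[R]_l) (v d : 'cV[R]_N).

Definition full_column_rank K := \rank (HK G H K) == (#|K| + l)%N.

(** The coefficients that live on K are encoded by vectors indexed by all rows, so
    that changing K does not change their type. *)
Definition supported K lam := forall i, i \notin K -> lam i 0 = 0.

(** The 0-1 matrix that keeps the coordinates in K; its transpose extends a
    vector by zero outside K. *)
Definition select K : 'M[R]_(#|K|, m) := rowsub (fun k : 'I_#|K| => enum_val k) 1%:M.

Lemma select_mulE p (M : 'M[R]_(m, p)) K k j : (select K *m M) k j = M (enum_val k) j.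
Proof. by rewrite /select mul_rowsub_mx mul1mx mxE. Qed.

Lemma rows_ofE p (M : 'M[R]_(m, p)) K : rows_of M K = select K *m M.
Proof. by rewrite /rows_of /select mul_rowsub_mx mul1mx. Qed.

Lemma rows_ofP p (M : 'M[R]_(m, p)) K (w : 'cV[R]_p) (c : 'cV[R]_m) :
  (forall i, i \in K -> (M *m w) i 0 = c i 0) <-> rows_of M K *m w = select K *m c.
Proof.
rewrite rows_ofE -mulmxA; split=> [E|E i iK].
  by apply/colP => k; rewrite !select_mulE; apply/E/enum_valP.
have := congr1 (fun z : 'cV_ _ => z (enum_rank_in iK i) 0) E.
by rewrite /= !select_mulE enum_rankK_in.
Qed.

Lemma select_supported K (c : 'cV[R]_#|K|) : supported K ((select K)^T *m c).
Proof.
move=> i iK; rewrite mxE big1// => k _; rewrite !mxE.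
by case: eqP => [e|]; rewrite ?mul0r//; move: iK; rewrite -e enum_valP.
Qed.

Lemma select_val K (c : 'cV[R]_#|K|) k : ((select K)^T *m c) (enum_val k) 0 = c k 0.
Proof.
rewrite mxE (bigD1 k)//= !mxE eqxx mul1r big1 ?addr0// => j jk; rewrite !mxE.
by rewrite (inj_eq enum_val_inj) (negbTE jk) mul0r.
Qed.

Lemma selectK K lam : supported K lam -> (select K)^T *m (select K *m lam) = lam.
Proof.
move=> s; apply/colP => i; have [iK|iK] := boolP (i \in K); last first.
  by rewrite (select_supported _ iK) s.
rewrite -(enum_rankK_in iK iK) select_val select_mulE.
by rewrite enum_rankK_in.
Qed.

Lemma HK_mul K (c : 'cV[R]_(#|K| + l)) :
  HK G H K *m c = G^T *m ((select K)^T *m usubmx c) + H^T *m dsubmx c.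
Proof.
by rewrite /HK -{1}(vsubmxK c) mul_row_col rows_ofE trmx_mul mulmxA.
Qed.

Lemma full_injP K :
  reflect (forall c : 'cV[R]_(#|K| + l), HK G H K *m c = 0 -> c = 0)
    (full_column_rank K).
Proof.
have -> : full_column_rank K = row_free (HK G H K)^T.
  by rewrite /full_column_rank /row_free mxrank_tr.
apply: (iffP idP) => [fr c c0|inj].
  apply: trmx_inj; apply: (row_free_inj fr).
  by rewrite -trmx_mul c0 !trmx0 mul0mx.
apply: inj_row_free => c c0; apply: trmx_inj; rewrite trmx0; apply: inj.
by apply: trmx_inj; rewrite trmx_mul trmxK trmx0.
Qed.

(** Full column rank as linear independence of the rows of G in K together with
    all the rows of H. *)
Lemma fullP K :
  reflect (forall lam mu, supported K lam -> G^T *m lam + H^T *m mu = 0 ->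
             lam = 0 /\ mu = 0) (full_column_rank K).
Proof.
apply: (iffP (full_injP K)) => [inj lam mu s e|inj c].
  have /inj c0 : HK G H K *m col_mx (select K *m lam) mu = 0.
    by rewrite HK_mul col_mxKu col_mxKd selectK.
  have := congr1 usubmx c0; have := congr1 dsubmx c0.
  rewrite col_mxKu col_mxKd !linear0 => -> s0; split => //.
  by rewrite -(selectK s) s0 mulmx0.
rewrite HK_mul => /(inj _ _ (select_supported _))[c1 c2].
rewrite -(vsubmxK c) c2 -[RHS](@col_mx0 _ #|K| l 1); congr col_mx.
by apply/colP => k; rewrite -select_val c1 !mxE.
Qed.

Lemma full0 : \rank H = l -> full_column_rank finset.set0.
Proof.
move=> rH; apply/fullP => lam mu s.
have -> : lam = 0 by apply/colP => i; rewrite s ?inE// mxE.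
rewrite mulmx0 add0r => e; split => //.
have fr : row_free H by rewrite /row_free rH.
apply: trmx_inj; apply: (row_free_inj fr).
by apply: trmx_inj; rewrite trmx_mul trmxK e trmx0 mul0mx trmx0.
Qed.

Lemma supportedS K K' lam : K \subset K' -> supported K lam -> supported K' lam.
Proof.
move=> KK' s i iK'; apply: s; apply: contra iK'.
exact: fintype.subsetP KK' i.
Qed.

Lemma fullS K K' : K \subset K' -> full_column_rank K' -> full_column_rank K.
Proof.
move=> KK' /fullP f; apply/fullP => lam mu s; apply: f; exact: supportedS s.
Qed.

Lemma dot_residual K lam mu d : supported K lam ->
  (forall i, i \in K -> (G *m d) i 0 = 0) -> H *m d = 0 ->
  dot d (G^T *m lam + H^T *m mu) = 0.
Proof.
move=> s Gd Hd; rewrite dotDr -!dot_mulmx Hd dot0l addr0 dotE big1// => i _.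
by have [/Gd ->|/s ->] := boolP (i \in K); rewrite ?mul0r ?mulr0.
Qed.

(** The vector d separates row i from the span of the others: d is orthogonal to
    the latter but not to the former. *)
Lemma fullU1 K i d : full_column_rank K -> H *m d = 0 ->
  (forall j, j \in K -> (G *m d) j 0 = 0) -> (G *m d) i 0 != 0 ->
  full_column_rank (i |: K)%SET.
Proof.
move=> /fullP f Hd Gd Gid; apply/fullP => lam mu s e; apply: f (e) => j jK.
have [->|ji] := eqVneq j i; last by apply: s; rewrite !inE negb_or ji.
have := congr1 (dot d) e; rewrite dot0r dotDr -!dot_mulmx Hd dot0l addr0 dotE.
rewrite (bigD1 i)//= big1 ?addr0 => [/eqP|k ki].
  by rewrite mulf_eq0 (negbTE Gid) => /eqP.
have [/Gd ->|kK] := boolP (k \in K); first by rewrite mul0r.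
by rewrite s ?mulr0// !inE negb_or ki.
Qed.

(** A vector c in the kernel of X^T X satisfies |X c|^2 = c^T X^T X c = 0. *)
Lemma gram_unit K : full_column_rank K -> (HK G H K)^T *m HK G H K \in unitmx.
Proof.
move=> /full_injP f; rewrite -row_free_unit; apply: inj_row_free => c c0.
apply: trmx_inj; rewrite trmx0; apply: f; apply/eqP; rewrite -dot_eq0.
rewrite dot_mulmx mulmxA; apply/eqP.
have -> : ((HK G H K)^T *m HK G H K) *m c^T = 0.
  by apply: trmx_inj; rewrite trmx_mul trmxK trmx_mul trmxK c0 trmx0.
exact: dot0r.
Qed.

(** The least squares coefficients of v on the columns of H_K. *)
Definition lsq_coef K v := invmx ((HK G H K)^T *m HK G H K) *m ((HK G H K)^T *m v).
Definition lsq_lam K v : 'cV[R]_m := (select K)^T *m usubmx (lsq_coef K v).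
Definition lsq_mu K v : 'cV[R]_l := dsubmx (lsq_coef K v).

Lemma JK_residual K v :
  JK G H K *m v = v - (G^T *m lsq_lam K v + H^T *m lsq_mu K v).
Proof.
by rewrite -HK_mul /JK mulmxBl mul1mx /lsq_coef !mulmxA.
Qed.

Lemma HK_tr_mul0 K d : (HK G H K)^T *m d = 0 <->
  (forall i, i \in K -> (G *m d) i 0 = 0) /\ H *m d = 0.
Proof.
have E : (HK G H K)^T *m d = col_mx (rows_of G K *m d) (H *m d).
  by rewrite /HK tr_row_mx !trmxK mul_col_mx.
have P : (forall i, i \in K -> (G *m d) i 0 = 0) <-> rows_of G K *m d = 0.
  have := rows_ofP G K d 0; rewrite mulmx0 => <-.
  by split=> h i /h ->; rewrite mxE.
rewrite E P; split=> [|[-> ->]]; last by rewrite col_mx0.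
move=> e; have := congr1 usubmx e; have := congr1 dsubmx e.
by rewrite col_mxKu col_mxKd !linear0 => -> ->.
Qed.

Lemma JK_orthogonal K v : full_column_rank K ->
  (forall i, i \in K -> (G *m (JK G H K *m v)) i 0 = 0) /\ H *m (JK G H K *m v) = 0.
Proof.
move=> f; apply/HK_tr_mul0; rewrite /JK mulmxBl mul1mx mulmxBr !mulmxA.
by rewrite mulmxV ?gram_unit// mul1mx subrr.
Qed.

End FullColumnRank.

Arguments select {R m} K.

(** * Nonnegative least squares *)

Section NNLS.
Variables (R : realType) (m l N : nat) (G : 'M[R]_(m, N)) (H : 'M[R]_(l, N)).
Implicit Types (K : {set 'I_m}) (lam : 'cV[R]_m) (mu : 'cV[R]_l) (v d : 'cV[R]_N).

Local Notation J := (JK G H).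
Local Notation full_column_rank := (full_column_rank G H).
Local Notation lsq_lam := (lsq_lam G H).
Local Notation lsq_mu := (lsq_mu G H).
Local Notation sqnorm u := (dot u u).

(** One inner loop of the Lawson-Hanson algorithm.  If the least squares
    solution on K has a negative coefficient, move from lam towards it until the
    first coefficient reaches zero; the residual does not grow, and that index
    leaves K. *)
Lemma nnls_descend K v lam mu : full_column_rank K -> supported K lam ->
  (forall i, 0 <= lam i 0) ->
  exists K', [/\ full_column_rank K', forall i, 0 <= lsq_lam K' v i 0 &
    sqnorm (J K' *m v) <= sqnorm (v - (G^T *m lam + H^T *m mu))].
Proof.
have [p] := ubnP #|K|; elim: p => // p ih in K lam mu * => Kp fK sK lam0.
move Els: (lsq_lam K v) => ls; move Ems: (lsq_mu K v) => ms.
move Ed: (J K *m v) => d.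
have sls : supported K ls by rewrite -Els; exact: select_supported.
have [w resE dw] : exists2 w, (forall t, v - (G^T *m (lam + t *: (ls - lam)) +
    H^T *m (mu + t *: (ms - mu))) = d + (1 - t) *: w) & dot d w = 0.
  exists (G^T *m (ls - lam) + H^T *m (ms - mu)) => [t|].
    rewrite -Ed JK_residual Els Ems !mulmxDr !mulmxN -!scalemxAr !mulmxDr !mulmxN.
    move: (G^T *m ls) (G^T *m lam) (H^T *m ms) (H^T *m mu) => x y z u.
    by apply/colP => j; rewrite !mxE; ring.
  have [] := JK_orthogonal v fK; rewrite Ed => Gd Hd.
  by apply: dot_residual Gd Hd => i iK; rewrite !mxE sls// sK// subrr.
have sqE t : sqnorm (d + (1 - t) *: w) = sqnorm d + (1 - t) ^+ 2 * sqnorm w.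
  by rewrite !dotE_lin (dotC w d) dw; ring.
have r0 : v - (G^T *m lam + H^T *m mu) = d + (1 - 0) *: w.
  by rewrite -resE !scale0r !addr0.
have [/forallP ls0|] := boolP [forall i, 0 <= ls i 0].
  exists K; split => //; first by rewrite Els.
  by rewrite Ed r0 sqE lerDl mulr_ge0 ?sqr_ge0 ?dot_ge0//.
rewrite negb_forall => /existsP[i0]; rewrite -ltNge => i0neg.
(* ratio i is the time at which coefficient i vanishes on the way to ls. *)
pose ratio i := lam i 0 / (lam i 0 - ls i 0).
have := @arg_minP _ R 'I_m i0 (fun i => ls i 0 < 0) ratio i0neg.
case=> k kneg kmin; set t := ratio k in kmin *.
have den0 i : ls i 0 < 0 -> 0 < lam i 0 - ls i 0.
  by move=> lsi; have := lam0 i; lra.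
have t0 : 0 <= t by rewrite /t /ratio divr_ge0// ltW// den0.
have t1 : t <= 1 by rewrite /t /ratio ler_pdivrMr ?den0// mul1r; lra.
have kK : k \in K by apply: contraTT kneg => /sls ->; rewrite ltxx.
pose lam' := lam + t *: (ls - lam).
have [|||| K' [fK' K'0 K'le]] := ih (K :\ k)%SET lam' (mu + t *: (ms - mu)).
- by rewrite (cardsD1 k K) kK in Kp.
- by apply: fullS fK; rewrite subD1set.
- move=> i; rewrite !inE negb_and negbK => /orP[/eqP->|iK].
    rewrite !mxE /t /ratio; field; rewrite gt_eqF// den0//.
  by rewrite !mxE sK// sls// subrr mulr0 addr0.
- move=> i; rewrite !mxE.
  have [lsi|lsi] := leP 0 (ls i 0).
    by have := lam0 i; move: (lam i 0) (ls i 0) lsi => x y; nra.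
  have := kmin i lsi; rewrite /ratio ler_pdivlMr ?den0//; lra.
- exists K'; split => //; apply: le_trans K'le _.
  rewrite /lam' resE sqE r0 sqE lerD2l ler_wpM2r ?dot_ge0// subr0 expr1n.
  by rewrite expr_le1//; lra.
Qed.

(** Among the finitely many independent K with nonnegative least squares
    coefficients choose one with the smallest residual d.  If row i had a
    positive inner product with d, then adding a small multiple of row i, which
    keeps independence, would decrease the residual, and [nnls_descend] would
    lead to a better K. *)
Theorem nnls v : \rank H = l ->
  exists K, [/\ full_column_rank K, forall i, 0 <= lsq_lam K v i 0 &
    forall i, (G *m (J K *m v)) i 0 <= 0].
Proof.
move=> rH; pose P K := full_column_rank K && [forall i, 0 <= lsq_lam K v i 0].
have [||K0 [fK0 K00 _]] := @nnls_descend finset.set0 v 0 0 (full0 G rH).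
- by move=> i _; rewrite mxE.
- by move=> i; rewrite mxE.
have PK0 : P K0 by apply/andP; split => //; apply/forallP.
have := @arg_minP _ R _ K0 P (fun K => sqnorm (J K *m v)) PK0.
case=> K /andP[fK /forallP K0'] Kmin; exists K; split => // i.
rewrite leNgt; apply/negP => Gi.
set d := J K *m v in Kmin Gi *; have [Gd Hd] := JK_orthogonal v fK.
pose g := G^T *m delta_mx i (0 : 'I_1).
have dg : dot g d = (G *m d) i 0.
  rewrite /g dot_mulmx trmxK dotE (bigD1 i)//= big1 ?addr0.
    by rewrite mxE !eqxx mul1r.
  by move=> j ji; rewrite mxE (negbTE ji) mul0r.
have g0 : 0 < sqnorm g.
  by rewrite dot_gt0; apply: contraTneq Gi => g0; rewrite -dg g0 dot0l ltxx.
(* e minimizes the norm of d - e g. *)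
pose e := (G *m d) i 0 / sqnorm g.
pose lam := lsq_lam K v + e *: delta_mx i 0.
have [||| K2 [fK2 K20 K2le]] := @nnls_descend (i |: K)%SET v lam (lsq_mu K v).
- by apply: fullU1 Hd Gd _ => //; rewrite gt_eqF.
- move=> j; rewrite !inE negb_or => /andP[ji jK].
  by rewrite [LHS]mxE [X in X + _](select_supported _ jK) !mxE (negbTE ji) mulr0 addr0.
- move=> j; rewrite [leRHS]mxE addr_ge0//.
  by rewrite !mxE mulr_ge0// divr_ge0 ?ltW.
have : sqnorm d <= sqnorm (J K2 *m v).
  by apply: Kmin; rewrite /P fK2; apply/forallP.
move=> /le_trans/(_ K2le); apply/negP; rewrite -ltNge.
have -> : v - (G^T *m lam + H^T *m lsq_mu K v) = d - e *: g.
  rewrite /d JK_residual /lam mulmxDr -scalemxAr -/g.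
  by rewrite !opprD -!addrA; congr (_ + _); congr (_ + _); exact: addrC.
rewrite !dotE_lin (dotC d g) dg /e; move: Gi g0.
move: ((G *m d) i 0) (sqnorm g) => s q s0 q0.
rewrite -subr_gt0; set z := (X in 0 < X); have -> : z = s ^+ 2 / q.
  by rewrite /z; field; rewrite gt_eqF.
by rewrite divr_gt0// exprn_gt0.
Qed.

End NNLS.

(** * Optimality conditions and the pieces of the projection *)

Section KKT.
Variables (R : realType) (m l n : nat).
Variables (A : 'M[R]_(m, n)) (a : 'cV[R]_m) (B : 'M[R]_(l, n)) (b : 'cV[R]_l).
Implicit Types (x y z : 'cV[R]_n) (K : {set 'I_m}) (lam : 'cV[R]_m) (mu : 'cV[R]_l).

Local Notation P := (polyhedron A a B b).
Local Notation Pi := (projection P).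
Local Notation J := (JK A B).
Local Notation full_column_rank := (full_column_rank A B).

(** First-order conditions for y to be the projection of x, with multipliers
    carried by a linearly independent set K of active constraints. *)
Record kkt x y K lam mu : Prop := Kkt {
  kkt_feasible : P y;
  kkt_stationary : x - y = A^T *m lam + B^T *m mu;
  kkt_sign : forall i, 0 <= lam i 0;
  kkt_supported : supported K lam;
  kkt_tight : forall i, i \in K -> (A *m y) i 0 = a i 0;
  kkt_full : full_column_rank K }.

(** The rows of the constraints on y - x are extended by the opposite of their
    right-hand side, and v is the last unit vector.  The residual is
    d = (d1, t) with t = <v, d> = |d|^2.  If t > 0, then y = x + d1 / t is
    feasible because G d <= 0 and H d = 0, and the multipliers are those of the
    least squares problem divided by t.  If t = 0, then v lies in the cone, which
    is a Farkas certificate that P is empty. *)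
Lemma kkt_exists x : \rank B = l -> P !=set0 -> exists y K lam mu, kkt x y K lam mu.
Proof.
move=> rB [z [Az Bz]].
pose a' := a - A *m x; pose b' := b - B *m x.
pose G : 'M[R]_(m, n + 1) := row_mx A (- a').
pose H : 'M[R]_(l, n + 1) := row_mx B (- b').
pose v : 'cV[R]_(n + 1) := col_mx 0 1%:M.
have rH : \rank H = l.
  apply/eqP; rewrite -[_ == _]/(row_free H); apply: inj_row_free => u.
  rewrite mul_mx_row -[RHS]row_mx0 => /eq_row_mx[uB _].
  have fB : row_free B by rewrite /row_free rB.
  by apply: (row_free_inj fB); rewrite uB mul0mx.
have [K [fK lam0 Gd]] := nnls G v rH.
have [GdK Hd] := JK_orthogonal v fK.
have dE := JK_residual G H K v.
have slam : supported K (lsq_lam G H K v) by exact: select_supported.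
move: (lsq_lam G H K v) (lsq_mu G H K v) (JK G H K *m v) lam0 slam Gd GdK Hd dE.
move=> lam mu d lam0 slam Gd GdK Hd dE.
have dt : dot d d = dot d v.
  by rewrite {2}dE dotDr dotNr (dot_residual mu slam GdK Hd) subr0.
have [d1 [t Ed]] : exists d1 t, d = col_mx d1 t%:M.
  by exists (usubmx d), (dsubmx d 0 0); rewrite -mx11_scalar vsubmxK.
rewrite Ed in Gd GdK Hd dE dt => {d Ed}.
have GE : G *m col_mx d1 t%:M = A *m d1 - t *: a'.
  by rewrite mul_row_col mul_mx_scalar scalerN.
have HE : H *m col_mx d1 t%:M = B *m d1 - t *: b'.
  by rewrite mul_row_col mul_mx_scalar scalerN.
have dotd : dot (col_mx d1 t%:M) (col_mx d1 t%:M) = dot d1 d1 + t * t.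
  by rewrite /dot tr_col_mx mul_row_col mxE tr_scalar_mx mul_scalar_mx !mxE eqxx.
have dotv : dot (col_mx d1 t%:M) v = t.
  by rewrite /dot tr_col_mx mul_row_col mulmx0 add0r mulmx1 !mxE eqxx.
have [d1E tE] : d1 = - (A^T *m lam + B^T *m mu) /\ t = 1 + (dot a' lam + dot b' mu).
  move: dE; rewrite /G /H !tr_row_mx !mul_col_mx add_col_mx opp_col_mx add_col_mx.
  move=> /eq_col_mx[-> e]; rewrite sub0r; split => //.
  have := congr1 (fun M : 'M[R]_1 => M 0 0) e; rewrite !linearN/= !mulNmx.
  by rewrite /dot !mxE eqxx mulr1n => ->; rewrite /=; ring.
rewrite dotd dotv in dt; rewrite GE in Gd GdK; rewrite HE in Hd => {GE HE dotd dotv dE}.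
have t0 : 0 < t.
  rewrite lt_neqAle -{2}dt addr_ge0 ?dot_ge0 -?expr2 ?sqr_ge0// andbT.
  apply/eqP => t0; move: dt; rewrite -t0 mulr0 addr0 => /eqP.
  rewrite dot_eq0 => /eqP d10.
  have : dot (z - x) d1 = 0 by rewrite d10 dot0r.
  rewrite d1E dotNr dotDr -!dot_mulmx !mulmxBr Bz -/b' => /eqP.
  rewrite oppr_eq0 => /eqP zd.
  have : dot (A *m z - A *m x) lam <= dot a' lam.
    rewrite !dotE; apply: ler_sum => i _; apply: ler_wpM2r => //.
    by rewrite !mxE lerD2r; have := Az i; rewrite mxE.
  by move: tE; rewrite -t0; lra.
have tn0 : t != 0 by rewrite gt_eqF.
have AyE i : (A *m (x + t^-1 *: d1)) i 0 = a i 0 + t^-1 * (A *m d1 - t *: a') i 0.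
  rewrite mulmxDr -scalemxAr /a' !mxE.
  by field.
exists (x + t^-1 *: d1), K, (t^-1 *: lam), (t^-1 *: mu); split.
- split=> [i|].
    by rewrite AyE gerDl; apply: mulr_ge0_le0 => //; rewrite invr_ge0 ltW.
  move/eqP: Hd; rewrite subr_eq0 => /eqP Hd.
  by rewrite mulmxDr -scalemxAr Hd scalerA mulVf// scale1r /b' addrC subrK.
- by rewrite d1E -!scalemxAr -scalerDr scalerN opprD opprK addrA subrr add0r.
- by move=> i; rewrite mxE mulr_ge0// invr_ge0 ltW.
- by move=> i /slam e; rewrite mxE e mulr0.
- by move=> i /GdK e; rewrite AyE e mulr0 addr0.
(* A linear relation between rows of A and B extends to the extra coordinate,
   because d1 / t turns each of these rows into its right-hand side. *)
- apply/fullP => lam' mu' s' e; have /fullP := fK; apply => //.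
  rewrite /G /H !tr_row_mx !mul_col_mx add_col_mx e -[RHS]col_mx0; congr col_mx.
  have : dot d1 (A^T *m lam' + B^T *m mu') = 0 by rewrite e dot0r.
  have Hd' : B *m d1 = t *: b' by apply/eqP; rewrite -subr_eq0 Hd.
  rewrite dotDr -!dot_mulmx Hd' dotZl.
  have -> : dot (A *m d1) lam' = t * dot a' lam'.
    rewrite !dotE mulr_sumr; apply: eq_bigr => i _.
    have [/GdK /eqP|/s' ->] := boolP (i \in K); last by rewrite !mulr0.
    by rewrite !mxE subr_eq0 => /eqP ->; rewrite mulrA.
  rewrite -mulrDr => /eqP; rewrite mulf_eq0 (negbTE tn0)/= => /eqP ab0.
  apply/matrixP => i j; rewrite !ord1 !linearN/= !mulNmx.
  by move: ab0; rewrite /dot !mxE; lra.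
Qed.

(** The multipliers are nonnegative and only tight constraints, which z cannot
    exceed, contribute to the inner product. *)
Lemma kkt_obtuse x y K lam mu z : kkt x y K lam mu -> P z -> dot (x - y) (z - y) <= 0.
Proof.
move=> [[Ay By] -> lam0 slam tight _] [Az Bz].
rewrite dotDl !dot_mulmx !trmxK !mulmxBr By Bz subrr dot0r addr0 dotE sumr_le0// => i _.
have [iK|/slam ->] := boolP (i \in K); last by rewrite mul0r.
by apply: mulr_ge0_le0 => //; have := Az i; have := tight i iK; rewrite !mxE; lra.
Qed.

Lemma kkt_dist x y K lam mu z : kkt x y K lam mu -> P z ->
  dot (y - x) (y - x) + dot (z - y) (z - y) <= dot (z - x) (z - x).
Proof.
move=> kxy Pz; have := kkt_obtuse kxy Pz.
have -> : z - x = (z - y) - (x - y) by apply/colP => i; rewrite !mxE; ring.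
rewrite -(opprB x y); move: (x - y) (z - y) => u w.
rewrite !dotE_lin (dotC w u); lra.
Qed.

Lemma kkt_projection x y K lam mu : kkt x y K lam mu -> Pi x = y.
Proof.
move=> kxy; apply: xget_unique.
  split=> [|z Pz]; first exact: kkt_feasible kxy.
  rewrite !norm2_sqr ler_pM2l ?invr_gt0//.
  by apply: le_trans (kkt_dist kxy Pz); rewrite lerDl dot_ge0.
move=> z [Pz /(_ y (kkt_feasible kxy))]; rewrite !norm2_sqr ler_pM2l ?invr_gt0// => zy.
have := le_trans (kkt_dist kxy Pz) zy; rewrite gerDl => zy0.
by apply/eqP; rewrite -subr_eq0 -dot_eq0 eq_le zy0 dot_ge0.
Qed.

Lemma projection_kkt x : \rank B = l -> P !=set0 ->
  exists K lam mu, kkt x (Pi x) K lam mu.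
Proof.
move=> rB P0; have [y [K [lam [mu kxy]]]] := kkt_exists x rB P0.
by exists K, lam, mu; rewrite (kkt_projection kxy).
Qed.

(** Adding the two obtuse angle inequalities gives
    |Pi x - Pi y|^2 <= <x - y, Pi x - Pi y>. *)
Lemma projection_nonexpansive x y : \rank B = l -> P !=set0 ->
  norm2 (Pi x - Pi y) <= norm2 (x - y).
Proof.
move=> rB P0; have [K [lam [mu kx]]] := projection_kkt x rB P0.
have [K' [lam' [mu' ky]]] := projection_kkt y rB P0.
have h1 := kkt_obtuse kx (kkt_feasible ky); have h2 := kkt_obtuse ky (kkt_feasible kx).
rewrite -(@ler_pXn2r _ 2) ?nnegrE ?sqrtr_ge0// !norm2_sqr.
move: (Pi x) (Pi y) h1 h2 {kx ky} => p q h1 h2.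
have pq : dot (p - q) (p - q) <= dot (x - y) (p - q).
  move: h1 h2; rewrite -(opprB p q) dotNr.
  have -> : x - y = (x - p) + ((p - q) - (y - q)).
    by apply/colP => i; rewrite !mxE; ring.
  move: (x - p) (y - q) (p - q) => u w d h1 h2.
  by rewrite !dotDl dotNl; lra.
have := dot_ge0 ((x - y) - (p - q)); move: (p - q) (x - y) pq => {h1 h2} d u du.
by rewrite !dotE_lin (dotC d u); lra.
Qed.

(** Complementary slackness holds term by term: the multipliers vanish outside K
    and the constraints in K are tight. *)
Lemma index_setsP x K : \rank B = l -> P !=set0 ->
  index_sets A a B b x K <-> exists lam mu, kkt x (Pi x) K lam mu.
Proof.
move=> rB P0; split=> [[[lam [mu [[st Ay By lam0 cs] sK Kact]]] rk]|[lam [mu k]]].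
  exists lam, mu; split => //.
  - by split=> // i; have := Ay i; rewrite !mxE; lra.
  - move/eqP: st; rewrite -addrA addr_eq0 => /eqP e.
    by rewrite -[RHS]opprK -e opprB.
  - move=> i iK; apply/eqP; rewrite eq_le lam0 andbT leNgt; apply: contra iK => li.
    by apply: (fintype.subsetP sK); rewrite inE.
  - by move=> i /(fintype.subsetP Kact); rewrite inE => /eqP.
  - exact/eqP.
case: k => -[Ay By] st lam0 slam tight fK; split; last exact/eqP.
exists lam, mu; split.
- split => //=.
  + by rewrite -addrA -st addrA subrK subrr.
  + by move=> i; have := Ay i; rewrite !mxE; lra.
  + apply/matrixP => i j; rewrite !ord1 mxE [RHS]mxE big1// => k _.
    rewrite mxE; have [/tight e|/slam ->] := boolP (k \in K); last by rewrite mul0r.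
    by rewrite [X in _ * X]mxE e mxE subrr mulr0.
- apply/fintype.subsetP => i; rewrite inE; apply: contraTT => /slam ->.
  by rewrite ltxx.
- by apply/fintype.subsetP => i /tight e; rewrite inE e.
Qed.

Lemma HK_tr_face y K : (forall i, i \in K -> (A *m y) i 0 = a i 0) -> B *m y = b ->
  (HK A B K)^T *m y = col_mx (select K *m a) b.
Proof.
by move=> /rows_ofP E By; rewrite /HK tr_row_mx !trmxK mul_col_mx E By.
Qed.

Definition gram_inv K := invmx ((HK A B K)^T *m HK A B K).

(** When H_K has full column rank, this is the point of the affine space
    A_K y = a_K, B y = b nearest to the origin: the constant c_K of the piece. *)
Definition face_offset K : 'cV[R]_n :=
  HK A B K *m (gram_inv K *m col_mx (select K *m a) b).

(** When H_K has full column rank, these are the coefficients on the columns of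
    H_K of x minus its projection onto the affine space A_K y = a_K, B y = b. *)
Definition face_multipliers K x :=
  gram_inv K *m ((HK A B K)^T *m x - col_mx (select K *m a) b).

Lemma face_stationary K x :
  x - (J K *m x + face_offset K) = HK A B K *m face_multipliers K x.
Proof.
rewrite /J /JK /face_offset /face_multipliers !mulmxBr mulmxBl mul1mx -/(gram_inv K).
by rewrite -!mulmxA opprD opprB addrA addrCA subrr addr0.
Qed.

Lemma HK_tr_face_point K x : full_column_rank K ->
  (HK A B K)^T *m (J K *m x + face_offset K) = col_mx (select K *m a) b.
Proof.
move=> fK; rewrite mulmxDr (HK_tr_mul0 A B K _).2; last exact: JK_orthogonal.
by rewrite add0r /face_offset !mulmxA mulmxV ?gram_unit// mul1mx.
Qed.

(** J_K annihilates x - y, which lies in the range of H_K, and J_K y differs from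
    y by a vector that depends only on H_K^T y = (a_K, b). *)
Lemma kkt_affine x y K lam mu : kkt x y K lam mu ->
  y = J K *m x + face_offset K /\ face_multipliers K x = col_mx (select K *m lam) mu.
Proof.
move=> [[Ay By] st lam0 slam tight fK].
have xy : x - y = HK A B K *m col_mx (select K *m lam) mu.
  by rewrite HK_mul col_mxKu col_mxKd selectK.
have fmE : face_multipliers K x = col_mx (select K *m lam) mu.
  rewrite /face_multipliers -(HK_tr_face tight By) -mulmxBr xy.
  rewrite (mulmxA (HK A B K)^T) (mulmxA (gram_inv K)).
  by rewrite mulVmx ?gram_unit// mul1mx.
split => //; have := face_stationary K x.
by rewrite fmE -xy => /addrI /oppr_inj.
Qed.

Lemma kkt_face x K : full_column_rank K ->
  (forall i, (A *m (J K *m x + face_offset K)) i 0 <= a i 0) ->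
  (forall k, 0 <= usubmx (face_multipliers K x) k 0) ->
  kkt x (J K *m x + face_offset K) K
    ((select K)^T *m usubmx (face_multipliers K x)) (dsubmx (face_multipliers K x)).
Proof.
move=> fK Ay q0; have := HK_tr_face_point x fK.
rewrite /HK tr_row_mx !trmxK mul_col_mx => /eq_col_mx[AK By].
split=> //.
- by rewrite face_stationary HK_mul.
- move=> i; rewrite mxE sumr_ge0// => k _; rewrite mulr_ge0//.
  by rewrite !mxE ler0n.
- exact: select_supported.
- exact/rows_ofP.
Qed.

(** The first m inequalities say that J_K x + c_K is feasible, the others that
    its multipliers on K are nonnegative. *)
Theorem index_sets_polyhedral K : \rank B = l -> P !=set0 -> full_column_rank K ->
  exists p (M : 'M[R]_(p, n)) (c : 'cV[R]_p),
    forall x, index_sets A a B b x K <-> forall i, (M *m x) i 0 <= c i 0.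
Proof.
move=> rB P0 fK.
pose M := col_mx (A *m J K) (- usubmx (gram_inv K *m (HK A B K)^T)).
pose c := col_mx (a - A *m face_offset K)
  (- usubmx (gram_inv K *m col_mx (select K *m a) b)).
exists (m + #|K|)%N, M, c => x.
have up i : (M *m x) (lshift _ i) 0 <= c (lshift _ i) 0 <->
    (A *m (J K *m x + face_offset K)) i 0 <= a i 0.
  rewrite mul_col_mx !col_mxEu mulmxDr mulmxA [X in _ <= X]mxE [X in _ + X]mxE.
  by rewrite [X in _ <-> X <= _]mxE lerBrDr.
have dn i : (M *m x) (rshift _ i) 0 <= c (rshift _ i) 0 <->
    0 <= usubmx (face_multipliers K x) i 0.
  rewrite mul_col_mx !col_mxEd mulNmx mul_usub_mx /face_multipliers mulmxBr mulmxA.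
  rewrite linearB/= [X in X <= _]mxE [X in _ <= X]mxE [X in _ <-> _ <= X]mxE.
  by rewrite [X in _ + X]mxE lerN2 subr_ge0.
split=> [/(index_setsP x K rB P0)[lam [mu k]] i|E].
  have [yE fmE] := kkt_affine k.
  case: (split_ordP i) => j ->; [apply/up|apply/dn].
    by rewrite -yE; case: (kkt_feasible k).
  by rewrite fmE col_mxKu select_mulE; exact: kkt_sign k _.
have k := kkt_face fK (fun i => (up i).1 (E _)) (fun j => (dn j).1 (E _)).
apply/index_setsP => //; rewrite (kkt_projection k).
by eexists; eexists; exact: k.
Qed.

Theorem projection_affine x K : \rank B = l -> P !=set0 ->
  index_sets A a B b x K -> Pi x = J K *m x + face_offset K.
Proof.
by move=> rB P0 /(index_setsP x K rB P0)[lam [mu /kkt_affine[]]].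
Qed.

Theorem index_sets_neq0 x : \rank B = l -> P !=set0 -> index_sets A a B b x !=set0.
Proof.
move=> rB P0; have [K [lam [mu k]]] := projection_kkt x rB P0.
by exists K; apply/index_setsP => //; exists lam, mu.
Qed.

End KKT.

(** * Semi-algebraicity *)

Section SemiAlgebraic.
Variables (R : realType) (N : nat).
Local Notation poly := (mpoly.mpoly N R).
Implicit Types (z : 'cV[R]_N) (S : set 'cV[R]_N).

(** A pair of polynomials stands for the condition p < 0, q = 0.  As this is a
    boolean, a set in disjunctive normal form is described by a list of lists of
    pairs, and unions and intersections become operations on lists. *)
Definition sat (pq : poly * poly) z := (peval pq.1 z < 0) && (peval pq.2 z == 0).

Definition dnf S := exists L : seq (seq (poly * poly)),
  forall z, S z <-> has (fun c => all (sat^~ z) c) L.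

(* Prepended to each conjunction, since the definition of a semi-algebraic set
   asks for at least one condition in each basic set. *)
Let true_cond : poly * poly := (mpoly.mpolyC N (-1), mpoly.mpolyC N 0).

Let sat_true z : sat true_cond z.
Proof. by rewrite /sat /peval/= !mpoly.mevalC ltrN10 eqxx. Qed.

Lemma dnf_semialgebraic S : dnf S -> semialgebraic S.
Proof.
move=> [L SL].
pose c j := true_cond :: nth [::] L j.
exists (size L), (fun j => size (c j)), (fun j i => (nth true_cond (c j) i).1),
  (fun j i => (nth true_cond (c j) i).2); split => //.
apply/seteqP; split=> z.
  move/SL => /(has_nthP [::])[j jL /allP jz]; exists j => // i /= ic.
  have : sat (nth true_cond (c j) i) z.
    have : nth true_cond (c j) i \in c j by exact: mem_nth.
    by rewrite inE => /orP[/eqP->|/jz].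
  by move=> /andP[p0 /eqP].
move=> [j /= jL H]; apply/SL/(has_nthP [::]); exists j => //.
apply/(all_nthP true_cond) => i ic.
have [p0 q0] := H i.+1 ic; apply/andP; split; last exact/eqP.
exact: p0.
Qed.

Lemma dnf_ext S S' : (forall z, S z <-> S' z) -> dnf S -> dnf S'.
Proof. by move=> SS' [L SL]; exists L => z; rewrite -SS'. Qed.

Lemma dnf_lt0 (p : poly) : dnf [set z | peval p z < 0].
Proof.
exists [:: [:: (p, mpoly.mpolyC N 0)]] => z.
by rewrite /= /sat /= /peval mpoly.mevalC eqxx !andbT orbF.
Qed.

Lemma dnf_eq0 (p : poly) : dnf [set z | peval p z = 0].
Proof.
exists [:: [:: (mpoly.mpolyC N (-1), p)]] => z.
rewrite /= /sat /= /peval mpoly.mevalC ltrN10 !andbT orbF /=.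
by split=> /eqP.
Qed.

Lemma dnfT : dnf setT.
Proof. by exists [:: [::]]. Qed.

Lemma dnf0 : dnf set0.
Proof. by exists [::]. Qed.

Lemma dnfU S S' : dnf S -> dnf S' -> dnf (S `|` S').
Proof.
move=> [L SL] [L' SL']; exists (L ++ L') => z; rewrite has_cat.
by split=> [[/SL->|/SL'->]//|/orP[/SL|/SL']]; rewrite ?orbT//; [left|right].
Qed.

Lemma dnfI S S' : dnf S -> dnf S' -> dnf (S `&` S').
Proof.
move=> [L SL] [L' SL']; exists [seq c ++ c' | c <- L, c' <- L'] => z; split.
  move=> [/SL/hasP[c cL cz] /SL'/hasP[c' cL' cz']].
  apply/hasP; exists (c ++ c'); first exact: allpairs_f.
  by rewrite all_cat cz.
move=> /hasP[_ /allpairsP[[c c'] /= [cL cL' ->]]]; rewrite all_cat => /andP[cz cz'].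
by split; [apply/SL|apply/SL']; apply/hasP; [exists c|exists c'].
Qed.

Lemma dnf_forall (I : finType) (S : I -> set 'cV[R]_N) :
  (forall i, dnf (S i)) -> dnf [set z | forall i, S i z].
Proof.
move=> dS; apply: (@dnf_ext [set z | forall i, i \in enum I -> S i z]).
  by move=> z; split=> H i; [apply: H; rewrite mem_enum|move=> _; exact: H].
elim: (enum I) => [|i s ih]; first by apply: dnf_ext dnfT => z.
apply: dnf_ext (dnfI (dS i) ih) => z; split=> [[Si H] j|H].
  by rewrite inE => /predU1P[->|/H].
by split=> [|j js]; apply: H; rewrite inE ?eqxx// js orbT.
Qed.

Lemma dnf_exists (I : finType) (S : I -> set 'cV[R]_N) :
  (forall i, dnf (S i)) -> dnf [set z | exists i, S i z].
Proof.
move=> dS; apply: (@dnf_ext [set z | exists2 i, i \in enum I & S i z]).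
  move=> z; split=> [[i _ Si]|[i Si]]; first by exists i.
  by exists i => //; rewrite mem_enum.
elim: (enum I) => [|i s ih]; first by apply: dnf_ext dnf0 => z; split=> // -[].
apply: dnf_ext (dnfU (dS i) ih) => z; split=> [[Si|[j js Sj]]|[j]].
- by exists i => //; rewrite inE eqxx.
- by exists j => //; rewrite inE js orbT.
- by rewrite inE => /predU1P[->|js Sj]; [left|right; exists j].
Qed.

Definition affine_poly (w : 'rV[R]_N) (c : R) : poly :=
  \sum_j w 0 j *: mpoly.mpolyX R (mpoly.mnm1 j) + mpoly.mpolyC N c.

Lemma peval_affine w c z : peval (affine_poly w c) z = (w *m z) 0 0 + c.
Proof.
rewrite /peval /affine_poly mpoly.mevalD mpoly.mevalC raddf_sum mxE; congr (_ + _).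
by apply: eq_bigr => j _; rewrite /= mpoly.mevalZ mpoly.mevalXU.
Qed.

(** A weak inequality is the union of a strict one and an equation. *)
Lemma dnf_mulmx_le p (M : 'M[R]_(p, N)) (c : 'cV[R]_p) :
  dnf [set z | forall i, (M *m z) i 0 <= c i 0].
Proof.
apply: dnf_forall => i.
apply: dnf_ext (dnfU (dnf_lt0 (affine_poly (row i M) (- c i 0)))
  (dnf_eq0 (affine_poly (row i M) (- c i 0)))) => z.
rewrite /setU /= peval_affine -row_mul mxE le_eqVlt; split.
  by case=> [|/eqP]; rewrite ?subr_lt0 ?subr_eq0 => ->; rewrite ?orbT.
by move=> /predU1P[->|]; [right; rewrite subrr|left; rewrite subr_lt0].
Qed.

Lemma dnf_mulmx_eq p (M : 'M[R]_(p, N)) (c : 'cV[R]_p) :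
  dnf [set z | M *m z = c].
Proof.
apply: dnf_ext (dnfI (dnf_mulmx_le M c) (dnf_mulmx_le (- M) (- c))) => z.
split=> [[le ge]|<- ]; last by split=> i //; rewrite mulNmx.
apply/colP => i; apply/eqP; rewrite eq_le le /=.
by have := ge i; rewrite mulNmx [X in X <= _]mxE [X in _ <= X]mxE lerN2.
Qed.

End SemiAlgebraic.

(** The graph is the union over K of the sets of pairs (x, J_K) with x in the
    polyhedron D_K, each of which is cut out by affine conditions. *)
Theorem HS_jacobian_semialgebraic (R : realType) (n m l : nat)
    (A : 'M[R]_(m, n)) (a : 'cV[R]_m) (B : 'M[R]_(l, n)) (b : 'cV[R]_l) :
  \rank B = l -> polyhedron A a B b !=set0 ->
  semialgebraic_mapping (HS_jacobian A a B b).
Proof.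
move=> rB P0; apply: dnf_semialgebraic.
pose S K : set 'cV[R]_(n + n * n) :=
  [set z | index_sets A a B b (usubmx z) K /\ dsubmx z = (mxvec (JK A B K))^T].
apply: (@dnf_ext _ _ [set z | exists K, S K z]) => [z|].
  split=> [[K [iK dz]]|[x [_ [[K iK ->] ->]]]].
    exists (usubmx z), (JK A B K); split; first by exists K.
    by rewrite -dz vsubmxK.
  by exists K; split; rewrite ?col_mxKu ?col_mxKd.
apply: dnf_exists => K.
have [fK|nfK] := boolP (full_column_rank A B K); last first.
  apply: dnf_ext (dnf0 _ _) => z; split=> // -[[_ /eqP]].
  by rewrite -/(full_column_rank _ _ _) (negbTE nfK).
have [p [M [c Mc]]] := index_sets_polyhedral rB P0 fK.
apply: dnf_ext (dnfI (dnf_mulmx_le (row_mx M 0) c)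
  (dnf_mulmx_eq (row_mx 0 1%:M) (mxvec (JK A B K))^T)) => z.
have E1 : row_mx M 0 *m z = M *m usubmx z.
  by rewrite -{1}(vsubmxK z) mul_row_col mul0mx addr0.
have E2 : row_mx 0 1%:M *m z = dsubmx z.
  by rewrite -{1}(vsubmxK z) mul_row_col mul0mx mul1mx add0r.
by rewrite /setI /S /= E1 E2; split=> -[/Mc].
Qed.

(** * Norms, limits along a set, and closed polyhedra *)

Section Norm2.
Variable R : realType.

Lemma coord_le_norm2 n (u : 'cV[R]_n) i : `|u i 0| <= norm2 u.
Proof.
rewrite -(@ler_pXn2r _ 2) ?nnegrE ?sqrtr_ge0// norm2_sqr real_normK ?num_real//.
rewrite dotE (bigD1 i)//= -expr2 lerDl sumr_ge0// => j _.
by rewrite -expr2 sqr_ge0.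
Qed.

Lemma mx_norm_le_norm2 n (u : 'cV[R]_n) : `|u| <= norm2 u.
Proof.
rewrite [leLHS]/Num.norm/= mx_normrE; apply: bigmax_le; first exact: sqrtr_ge0.
by move=> [i j] _ /=; rewrite ord1 coord_le_norm2.
Qed.

Lemma coord_le_mx_norm n (u : 'cV[R]_n) i : `|u i 0| <= `|u|.
Proof.
rewrite [leRHS]/Num.norm/= mx_normrE.
exact: (le_bigmax _ (fun ij : 'I_n * 'I_1 => `|u ij.1 ij.2|) (i, 0)).
Qed.

Lemma norm2_le_mx_norm n (u : 'cV[R]_n) : norm2 u <= n%:R * `|u|.
Proof.
rewrite -(@ler_pXn2r _ 2) ?nnegrE ?sqrtr_ge0 ?mulr_ge0 ?ler0n// norm2_sqr.
rewrite dotE; apply: (@le_trans _ _ (\sum_(i < n) `|u| ^+ 2)).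
  apply: ler_sum => i _; rewrite -expr2 -[leLHS]real_normK ?num_real//.
  by rewrite ler_pXn2r ?nnegrE// coord_le_mx_norm.
rewrite sumr_const card_ord exprMn -[leLHS]mulr_natl ler_wpM2r ?sqr_ge0//.
by rewrite -natrX ler_nat; case: n u => // k _; rewrite expnS expn1 leq_pmulr.
Qed.

End Norm2.

Section Calculus.
Variable R : realType.

(** The difference quotient of phi vanishes along T, so it cannot tend to a
    nonzero limit unless t is isolated in T. *)
Lemma derive0_limit_point (phi : R -> R) (T : set R) t : derivable phi t 1 ->
  (forall s, T s -> phi s = 0) -> T t -> ~ isolated T t -> 'D_1 phi t = 0.
Proof.
move=> dphi phi0 Tt niso; apply/eqP/negPn/negP => D0; apply: niso.
split; first exact/mem_set.
have /cvgrPdist_lt/(_ `|'D_1 phi t|) :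
    (fun h => h^-1 *: ((phi \o shift t) (h *: 1) - phi t)) @ 0^' --> 'D_1 phi t.
  exact: dphi.
rewrite normr_gt0 => /(_ D0)/dnbhs0P[e e0 eP].
exists (ball t e); first exact: nbhsx_ballx.
apply/seteqP; split=> [s [ts Ts]|_ ->]; last by split => //; exact: ballxx.
apply/eqP; apply/negPn/negP => /= st.
have := eP (s - t); rewrite subr_eq0 => /(_ _ st).
rewrite /= /GRing.scale/= mulr1 subrK !phi0// subrr mulr0 subr0 ltxx => H.
by suff : false by []; apply: H; rewrite distrC.
Qed.

Lemma mulmx_coord_continuous p n (M : 'M[R]_(p, n)) i :
  continuous (fun x : 'cV[R]_n => (M *m x) i 0).
Proof.
have -> : (fun x : 'cV[R]_n => (M *m x) i 0) = (fun x => \sum_j M i j * x j 0).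
  by apply/funext => x; rewrite mxE.
elim: (index_enum _) => [|j s ih].
  rewrite (_ : (fun x : 'cV[R]_n => _) = cst 0); first exact: cst_continuous.
  by apply/funext => x; rewrite big_nil.
rewrite (_ : (fun x : 'cV[R]_n => _) =
    (fun x => M i j * x j 0 + \sum_(k <- s) M i k * x k 0)); last first.
  by apply/funext => x; rewrite big_cons.
move=> x; apply: cvgD (ih x); apply: cvgM; first exact: cvg_cst.
exact: coord_continuous.
Qed.

Lemma closed_mulmx_le p n (M : 'M[R]_(p, n)) (c : 'cV[R]_p) :
  closed [set x : 'cV[R]_n | forall i, (M *m x) i 0 <= c i 0].
Proof.
rewrite (_ : [set x | _] = \bigcap_(i in setT)
  ((fun x : 'cV[R]_n => (M *m x) i 0) @^-1` [set y | y <= c i 0])).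
  apply: closed_bigI => i _; apply: preimage_closed; last exact: closed_le.
  by move=> x _; exact: mulmx_coord_continuous.
by apply/seteqP; split=> x H i; [move=> _|]; exact: H.
Qed.

End Calculus.

(** * Conservativity *)

Section Conservative.
Variables (R : realType).
Notation mu := (@lebesgue_measure R).

Lemma negligible_exists (I : finType) (S : I -> set R) :
  (forall i, mu.-negligible (S i)) -> mu.-negligible [set x | exists i, S i x].
Proof.
move=> nS; have H (s : seq I) : mu.-negligible [set x | exists2 i, i \in s & S i x].
  elim: s => [|i s ih].
    by apply: negligibleS (negligible_set0 _) => x [].
  apply: negligibleS (negligibleU (nS i) ih) => x [j]; rewrite inE.
  by move=> /predU1P[->|js Sj]; [left|right; exists j].
by apply: negligibleS (H (enum I)) => x [i Si]; exists i; rewrite ?mem_enum.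
Qed.

Lemma countable_negligible (C : set R) : countable C -> mu.-negligible C.
Proof.
move=> cC; apply/negligible_outer_measure.
exact: countable_lebesgue_measure0.
Qed.

Lemma abs_continuous01_coord n (g : R -> 'cV[R]_n) i :
  abs_continuous01 g -> abs_continuous01_real (fun t => g t i 0).
Proof.
move=> gac e e0; have [d d0 dP] := gac e e0; exists d => // N s t st dst std.
apply: le_lt_trans (dP N s t st dst std); apply: ler_sum => k _.
by have := coord_le_norm2 (g (t k) - g (s k)) i; rewrite !mxE.
Qed.

Lemma abs_continuous01_nonexpansive n p (f : 'cV[R]_n -> 'cV[R]_p) g :
  (forall x y, norm2 (f x - f y) <= norm2 (x - y)) ->
  abs_continuous01 g -> abs_continuous01 (f \o g).
Proof.
move=> fne gac e e0; have [d d0 dP] := gac e e0; exists d => // N s t st dst std.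
by apply: le_lt_trans (dP N s t st dst std); apply: ler_sum => k _; exact: fne.
Qed.

Lemma curve_derivable_ae n (g : R -> 'cV[R]_n) : abs_continuous01 g ->
  mu.-negligible [set t | 0 < t < 1 /\ ~ derivable g t 1].
Proof.
move=> gac.
have H i := abs_continuous01_derivable_ae (abs_continuous01_coord i gac).
apply: negligibleS (negligible_exists H) => t [t01 nd].
apply: contrapT => /forallNP nH; apply: nd; apply/derivable_mxP => i j.
rewrite ord1; apply: contrapT => nd; exact: (nH i).
Qed.

(** The chain rule along a piece: h - V g - c vanishes on T, hence so does its
    derivative at the accumulation points of T. *)
Lemma derive_affine_on n p (g : R -> 'cV[R]_n) (h : R -> 'cV[R]_p)
    (V : 'M[R]_(p, n)) c (T : set R) t :
  derivable g t 1 -> derivable h t 1 ->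
  (forall s, T s -> h s = V *m g s + c) -> T t -> ~ isolated T t ->
  derive1 h t = V *m derive1 g t.
Proof.
move=> dg dh hT Tt niso; apply/matrixP => i j; rewrite ord1 !derive1E {j}.
rewrite derive_mx// mxE [RHS]mxE.
have dgj (j : 'I_n) : derivable (fun s => g s j 0) t 1.
  by move/derivable_mxP : dg; apply.
have dhi : derivable (fun s => h s i 0) t 1 by move/derivable_mxP : dh; apply.
pose S := \sum_j (V i j \*: (fun s => g s j 0)).
have dS : derivable S t 1.
  by rewrite /S; apply: derivable_sum => j; exact: derivableZ (dgj j).
pose phi := (fun s => h s i 0) - S - cst (c i 0).
have : 'D_1 phi t = 0.
  apply: derive0_limit_point Tt niso.
    exact: derivableB (derivableB dhi dS) (derivable_cst _ _ _).
  move=> s /hT hs; rewrite /phi /S.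
  rewrite !fctE hs !mxE.
  by rewrite fct_sumE addrAC addrK subrr.
rewrite (deriveB (derivableB dhi dS) (derivable_cst _ _ _)) derive_cst subr0.
rewrite (deriveB dhi dS) => /eqP; rewrite subr_eq0 => /eqP ->.
rewrite (derive_sum (fun j => derivableZ (k := V i j) (dgj j))).
apply: eq_bigr => j _; rewrite (deriveZ (V i j) (dgj j)).
by rewrite derive_mx// mxE.
Qed.

End Conservative.

(** The graph is the finite union of the closed sets D_K x {J_K}, which settles
    the topological conditions on the values.  The exceptional times are the
    endpoints 0 and 1, the times where g or Pi o g is not differentiable, and
    the isolated points of the sets of times that g spends in D_K. *)
Theorem HS_jacobian_conservative (R : realType) (n m l : nat)
    (A : 'M[R]_(m, n)) (a : 'cV[R]_m) (B : 'M[R]_(l, n)) (b : 'cV[R]_l) :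
  \rank B = l -> polyhedron A a B b !=set0 ->
  conservative_mapping (projection (polyhedron A a B b)) (HS_jacobian A a B b).
Proof.
move=> rB P0; pose D K := [set x | index_sets A a B b x K].
have Dclosed K : closed (D K).
  have [fK|nfK] := boolP (full_column_rank A B K).
    have [p [M [c Mc]]] := index_sets_polyhedral rB P0 fK.
    rewrite (_ : D K = [set x | forall i, (M *m x) i 0 <= c i 0]).
      exact: closed_mulmx_le.
    by apply/seteqP; split=> x /Mc.
  rewrite (_ : D K = set0); first exact: closed0.
  apply/seteqP; split=> // x [_ /eqP].
  by rewrite -/(full_column_rank _ _ _) (negbTE nfK).
have nonexp x y := projection_nonexpansive x y rB P0.
split.
- move=> x; exists n%:R, setT; first exact: filterT.
  move=> [y z] _ /=; apply: le_trans (mx_norm_le_norm2 _) _.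
  exact: le_trans (nonexp y z) (norm2_le_mx_norm _).
- move=> x; have [K iK] := index_sets_neq0 x rB P0.
  by exists (JK A B K), K.
- move=> x; apply: finite_compact.
  apply: (@sub_finite_set _ _ (range (JK A B))); first by move=> J [K _ ->]; exists K.
  exact: finite_image.
- rewrite (_ : [set xV | _] = \bigcup_(K in setT)
      ((fst @^-1` D K) `&` (snd @^-1` [set JK A B K]))); last first.
    apply/seteqP; split=> [[x V] [K iK /= ->]|[x V] [K _ [iK VK]]]; first by exists K.
    by exists K.
  apply: closed_bigcup; first exact: finite_finset.
  move=> K _; apply: closedI; apply: preimage_closed => //.
  + by move=> xV _; exact: cvg_fst.
  + by move=> xV _; exact: cvg_snd.
  + apply: accessible_closed_set1; apply: hausdorff_accessible.
    exact: norm_hausdorff.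
- move=> g gac.
  have fgac := abs_continuous01_nonexpansive nonexp gac.
  pose T K := [set t | D K (g t)].
  have nT K := countable_negligible (@countable_isolated _ (T K)).
  have n01 : countable ([set 0; 1] : set R) by exact: finite_set_countable.
  have {}n01 := countable_negligible n01.
  apply: negligibleS (negligibleU n01 (negligibleU (negligible_exists nT)
    (negligibleU (curve_derivable_ae gac) (curve_derivable_ae fgac)))).
  move=> t; apply: contra_notP => /not_orP[n01t /not_orP[niso /not_orP[ndg ndf]]].
  move=> /andP[t0 t1].
  have t01 : 0 < t < 1.
    rewrite !lt_neqAle t0 t1 !andbT eq_sym.
    apply/andP; split; apply/eqP => e; apply: n01t.
      by left.
    by right.
  have dg : derivable g t 1 by exact: contrapT (fun nd => ndg (conj t01 nd)).
  have df : derivable (projection (polyhedron A a B b) \o g) t 1.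
    exact: contrapT (fun nd => ndf (conj t01 nd)).
  split => // V [K iK ->].
  apply: (derive_affine_on (T := T K) (c := face_offset A a B b K)) => //.
    by move=> s /= Ts; exact: projection_affine.
  by move=> isoK; apply: niso; exists K.
Qed.

Unset Implicit Arguments.

Theorem theorem2 (R : realType) (n m l : nat)
    (A : 'M[R]_(m, n)) (a : 'cV[R]_m) (B : 'M[R]_(l, n)) (b : 'cV[R]_l)
    (B_full_row_rank : \rank B = l)
    (P_nonempty : polyhedron A a B b !=set0) :
  semialgebraic_mapping (HS_jacobian A a B b) /\
  conservative_mapping (projection (polyhedron A a B b))
    (HS_jacobian A a B b).
Proof.
by split; [exact: HS_jacobian_semialgebraic|exact: HS_jacobian_conservative].
Qed.
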